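(* Let $\Delta\ge3$ and $0\le C\le\Delta-3$. For every $n$ there exists a graph $G$ (on at most $n$ vertices) with maximum degree $\Delta$ that is properly $(\Delta+C)$-edge colored except for one uncolored edge $e$, such that: the coloring can be extended to a proper $(\Delta+C)$-edge coloring of $G$ while recoloring only $O(1)$ edges, but any shift-based algorithm has recourse $\Omega(n/\Delta)$ if $C=0$, and recourse $\Omega\!\left(\log\frac{nC}{(\Delta-C)^2}\big/\log\frac{\Delta+C}{\Delta-C}\right)$ if $C\ge1$. The latter expression simplifies as follows: if $C\le\frac{\Delta}{3}$ it is $\Omega(\frac{\Delta}{C}\log\frac{nC}{\Delta^2})$; if $C=\epsilon\Delta$ for a constant $\epsilon>0$ it is $\Omega(\log(n/\Delta))$; and if $C=\Delta-O(1)$ it is $\Omega(\frac{\log n}{\log\Delta})$.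
   Context: A sequence of edges $S=[e_1,\dots,e_k]$ is a chain if for each $i\in[1,k-1]$, $e_i$ and $e_{i+1}$ share exactly one endpoint. Given a partially (properly) colored graph, a chain $S$ is shiftable if for every prefix of $S$, shifting colors along it (each $e_i$ receives the current color of $e_{i+1}$, and the last edge of the prefix becomes uncolored) yields a proper partial coloring. If $e_1$ is uncolored and after shifting along $S$ the last edge $e_k$ can be given a color not used by any of its adjacent edges, $S$ is useful. An algorithm is shift-based if it extends the coloring to an uncolored edge only by shifting along a useful shiftable chain beginning at that edge and then coloring the last edge; its recourse is the number of previously colored edges whose color changes. *)

(* Defs.v *)
From HB Require Import structures.
From mathcomp Require Import all_boot all_order all_algebra.
From mathcomp Require Import reals exp.

Set Implicit Arguments.
Unset Strict Implicit.
Unset Printing Implicit Defensive.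

Import Order.TTheory GRing.Theory Num.Theory.

Record sgraph := SGraph {
  vertex :> finType;
  adj : rel vertex;
  adj_sym : symmetric adj;
  adj_irrefl : irreflexive adj }.

Definition max_degree (G : sgraph) : nat :=
  \max_(x : G) #|[set y : G | adj x y]|.

Definition edge_set (G : sgraph) : {set {set G}} :=
  [set A : {set G} | [exists x, exists y, adj x y && (A == [set x; y])]].

Notation edge G := {A : {set vertex G} | A \in edge_set G}.

Section Coloring.
Variables (G : sgraph) (k : nat).

(* [None] marks an uncolored edge. *)
Definition coloring := {ffun edge G -> option 'I_k}.

Definition share_one_endpoint (e f : edge G) : bool :=
  #|val e :&: val f| == 1.

Definition proper_coloring (phi : coloring) : Prop :=
  forall (e f : edge G) (c : 'I_k),
    share_one_endpoint e f -> phi e = Some c -> phi f <> Some c.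

Definition fully_colored (phi : coloring) : Prop := forall f, phi f <> None.

(* Edges may repeat in a chain. *)
Definition chain (S : seq (edge G)) : bool := sorted share_one_endpoint S.

Definition shift1 (phi : coloring) (e f : edge G) : coloring :=
  [ffun g => if g == e then phi f else if g == f then None else phi g].

(* Colors move one step at a time, so "the current color" of a repeated edge
   is the one it holds when the shift reaches it. *)
Fixpoint shift (phi : coloring) (S : seq (edge G)) : coloring :=
  if S is e :: S' then
    if S' is f :: _ then shift (shift1 phi e f) S' else phi
  else phi.

Definition shiftable (phi : coloring) (S : seq (edge G)) : Prop :=
  forall i : nat, i <= size S -> proper_coloring (shift phi (take i S)).

Definition available (phi : coloring) (e : edge G) (c : 'I_k) : Prop :=
  forall f, share_one_endpoint e f -> phi f <> Some c.

Definition useful (phi : coloring) (S : seq (edge G)) : Prop :=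
  if S is e :: s then
    phi e = None /\ exists c, available (shift phi S) (last e s) c
  else False.

Definition color_edge (phi : coloring) (e : edge G) (c : 'I_k) : coloring :=
  [ffun g => if g == e then Some c else phi g].

Definition shift_extends (phi : coloring) (e : edge G) (psi : coloring) : Prop :=
  exists (s : seq (edge G)) (c : 'I_k),
    let S := e :: s in
    [/\ chain S, shiftable phi S, useful phi S,
        available (shift phi S) (last e s) c &
        psi = color_edge (shift phi S) (last e s) c].

(* [A phi e psi]: on the partial coloring [phi] and the uncolored edge [e],
   the (possibly nondeterministic) algorithm may output [psi]. *)
Definition algorithm := coloring -> edge G -> coloring -> Prop.

Definition shift_based (A : algorithm) : Prop :=
  forall (phi : coloring) (e : edge G) (psi : coloring),
    proper_coloring phi -> phi e = None -> A phi e psi -> shift_extends phi e psi.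

Definition recourse (phi psi : coloring) : nat :=
  #|[set f | (phi f != None) && (psi f != phi f)]|.

End Coloring.

Section Bounds.
Local Open Scope ring_scope.
Variable R : realType.

Definition log_bound (D C n : nat) : R :=
  ln (n%:R * C%:R / (D%:R - C%:R) ^+ 2) /
  ln ((D%:R + C%:R) / (D%:R - C%:R)).

Definition recourse_bound (D C n : nat) : R :=
  if C == 0%N then n%:R / D%:R else log_bound D C n.

End Bounds.

(* Main.v *)
(** The lower-bound graph is layered: every vertex below the top layer has [a]
    edges to the next layer, at most [b] edges to the previous one, and [q]
    leaves, where [D = a + b + q], [D + C = 2 a + q] and [q] is 1 or 2. Layers
    alternately use two disjoint palettes of [a] colors for their upward edges,
    and the leaf edges use the remaining [q] colors. The uncolored edge sits at
    the bottom; recoloring one leaf edge at each of its ends frees a leaf color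
    for it.

    A shift can move a leaf color only to an edge that has an endpoint at a leaf
    or in the top layer. Hence in the output of a shift-based algorithm no edge
    below the top has a leaf color, and then pigeonhole at one vertex after the
    other gives, in every gap between layers, an edge whose color comes from the
    palette of the wrong parity. The recourse is therefore at least the number
    of layers minus a constant, and layer sizes growing by the factor [a / b]
    make that number logarithmic (linear if [C = 0]) in [n]. If [n] is too small
    for four layers, a graph on [D + 1] vertices that forces one change suffices. *)
Require Import Defs.
From HB Require Import structures.
From mathcomp Require Import all_boot all_order all_algebra.
From mathcomp Require Import reals exp.
From mathcomp Require Import zify ring lra.

Set Implicit Arguments.
Unset Strict Implicit.
Unset Printing Implicit Defensive.

Import Order.TTheory GRing.Theory Num.Theory.

(** * Shifts *)

Section Shifts.
Variables (G : sgraph) (k : nat).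
Implicit Types (e f g : edge G) (x y z : G) (phi psi : coloring G k) (c : 'I_k).

Definition sees phi x c := exists2 f : edge G, x \in val f & phi f = Some c.

Lemma edgeP f : exists x y, adj x y /\ val f = [set x; y].
Proof.
case: f => A /=; rewrite inE => /existsP[x /existsP[y /andP[xy /eqP ->]]].
by exists x, y.
Qed.

Lemma adj_neq x y : adj x y -> x != y.
Proof. by apply: contraTneq => ->; rewrite adj_irrefl. Qed.

Lemma edge_eq e f x y : x != y ->
  x \in val e -> y \in val e -> x \in val f -> y \in val f -> e = f.
Proof.
move=> xy xe ye xf yf; apply: val_inj.
have pairE g : x \in val g -> y \in val g -> val g = [set x; y].
  have [z [t [_ ->]]] := edgeP g; rewrite !inE.
  case/orP=> /eqP xE /orP[] /eqP yE; rewrite -?xE -?yE //.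
  - by rewrite xE yE eqxx in xy.
  - by rewrite setUC.
  - by rewrite xE yE eqxx in xy.
by rewrite (pairE e) // (pairE f).
Qed.

Lemma edge_other f x : x \in val f -> exists y, adj x y /\ val f = [set x; y].
Proof.
have [z [t [zt ->]]] := edgeP f; rewrite !inE => /orP[]/eqP->; first by exists t.
by exists z; split; [rewrite adj_sym | rewrite setUC].
Qed.

Lemma share_neq e f : share_one_endpoint e f -> e != f.
Proof.
apply: contraTneq => ->; rewrite /share_one_endpoint setIid.
by have [x [y [/adj_neq xy ->]]] := edgeP f; rewrite cards2 xy.
Qed.

Lemma share_edges e f x : e != f -> x \in val e -> x \in val f ->
  share_one_endpoint e f.
Proof.
move=> ef xe xf; rewrite /share_one_endpoint; apply/cards1P; exists x.
apply/setP => y; rewrite !inE; apply/andP/eqP => [[ye yf]|-> //].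
apply: contraNeq ef => yx; apply/eqP; exact: (edge_eq yx).
Qed.

Lemma shareP e f : share_one_endpoint e f ->
  exists z x y, [/\ x != z, y != z, x != y, val e = [set z; x] & val f = [set z; y]].
Proof.
move=> ef; have nef := share_neq ef; have /cards1P[z efz] := ef.
have : z \in val e :&: val f by rewrite efz inE.
rewrite inE => /andP[ze zf].
have [x [zx eE]] := edge_other ze; have [y [zy fE]] := edge_other zf.
exists z, x, y; rewrite eq_sym (adj_neq zx) eq_sym (adj_neq zy); split=> //.
by apply: contraNneq nef => xy; apply/eqP/val_inj; rewrite eE fE xy.
Qed.

Lemma properP phi : proper_coloring phi <->
  (forall e f x c, x \in val e -> x \in val f ->
     phi e = Some c -> phi f = Some c -> e = f).
Proof.
split=> [phiP e f x c xe xf pe pf | phiP e f c ef pe pf].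
  apply/eqP; apply: contraT => ef.
  by case: (phiP _ _ c (share_edges ef xe xf) pe).
have [z [x [y [_ _ _ eE fE]]]] := shareP ef.
by move: (share_neq ef); rewrite (phiP e f z c) ?eqxx // ?eE ?fE !inE eqxx.
Qed.

Lemma color_edgeE phi e c f :
  color_edge phi e c f = if f == e then Some c else phi f.
Proof. by rewrite ffunE. Qed.

Lemma shift1E phi e f g :
  shift1 phi e f g = if g == e then phi f else if g == f then None else phi g.
Proof. by rewrite ffunE. Qed.

Lemma color_edge_proper phi e c :
  proper_coloring phi -> available phi e c -> proper_coloring (color_edge phi e c).
Proof.
move=> phiP av f g d fg; rewrite !color_edgeE.
case: (f =P e) fg => [->|_] fg; case: (g =P e) fg => [->|_] fg //.
- by have := share_neq fg; rewrite eqxx.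
- by case=> <-; apply: av.
- move=> pf [dc]; subst d; apply: (av f) => //.
  by rewrite /share_one_endpoint setIC.
- exact: phiP.
Qed.

Lemma availableP phi e c :
  (forall x f, x \in val e -> x \in val f -> f != e -> phi f != Some c) ->
  available phi e c.
Proof.
move=> av f ef; have [z [x [y [_ _ _ eE fE]]]] := shareP ef.
by apply/eqP/(av z); rewrite ?eE ?fE ?inE ?eqxx // eq_sym share_neq.
Qed.

(** The new color of [e] can clash only at [x]: at the shared endpoint, [f] already kept [c] off
    every other edge. *)
Lemma shift1_proper phi e f x c :
  proper_coloring phi -> share_one_endpoint e f ->
  x \in val e -> x \notin val f -> phi f = Some c -> ~ sees phi x c ->
  proper_coloring (shift1 phi e f).
Proof.
move=> /properP phiP ef xe xf fc nsee.
have aux g y : y \in val e -> y \in val g -> g != e -> g != f -> phi g <> Some c.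
  move=> ye yg ge gf gc; have [yx|yx] := eqVneq y x.
    by apply: nsee; exists g; rewrite -?yx.
  have [z [s [t [_ _ _ eE fE]]]] := shareP ef.
  suff yf : y \in val f by move: gf; rewrite (phiP _ _ _ _ yg yf gc fc) eqxx.
  have zx : z != x by apply: contraNneq xf => <-; rewrite fE !inE eqxx.
  move: xe ye; rewrite eE fE !inE => /orP[]/eqP xz; subst x.
    by rewrite eqxx in zx.
  by rewrite (negPf yx) orbF => ->.
apply/properP => g h y d; rewrite !shift1E.
case: (eqVneq g e) => [->|ge]; case: (eqVneq h e) => [->|he] // yg yh.
- by rewrite fc => -[<-]; case: eqVneq => // hf hc; case: (aux h y).
- by case: eqVneq => // gf gc; rewrite fc => -[dc]; case: (aux g y); rewrite ?dc.
- by case: eqVneq => // _; case: eqVneq => // _; apply: (phiP g h y).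
Qed.

Lemma shift_extends_color phi e c : proper_coloring phi -> phi e = None ->
  available phi e c -> shift_extends phi e (color_edge phi e c).
Proof.
move=> phiP pe av; exists [::], c; split=> //.
- by move=> [|[|i]].
- by split=> //; exists c.
Qed.

Lemma shift_extends_step phi e f psi : proper_coloring phi -> phi e = None ->
  share_one_endpoint e f -> shift_extends (shift1 phi e f) f psi ->
  shift_extends phi e psi.
Proof.
move=> phiP pe ef [s [c [ch sh us av ->]]]; exists (f :: s), c; split=> //.
- by rewrite /chain /= ef.
- move=> [|[|i]] // ile; exact: (sh i.+1).
- by split=> //; case: us.
Qed.

(** [I] is an invariant of the coloring together with its current uncolored edge. A step may assume
    properness before and after, because shiftability makes every prefix proper. *)
Lemma shift_extends_ind (I : coloring G k -> edge G -> Prop) phi e psi :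
  (forall phi' e f, I phi' e -> share_one_endpoint e f ->
     proper_coloring phi' -> phi' e = None ->
     proper_coloring (shift1 phi' e f) -> I (shift1 phi' e f) f) ->
  I phi e -> shift_extends phi e psi ->
  exists (phi' : coloring G k) (f : edge G) (c : 'I_k), [/\ I phi' f, proper_coloring phi', phi' f = None,
    available phi' f c & psi = color_edge phi' f c].
Proof.
move=> Istep I0 [s [c []]]; elim: s phi e I0 => [|f s IH] phi e I0.
  move=> _ sh [pe _] av ->; exists phi, e, c; split=> //; exact: (sh 0).
move=> /= /andP[ef fs] sh [pe us] av psiE.
have phiP : proper_coloring phi by exact: (sh 0).
have sP : proper_coloring (shift1 phi e f).
  by have := sh 2; rewrite /= take0; apply.
apply: (IH (shift1 phi e f) f) => //.
- exact: Istep.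
(* A prefix of length one shifts nothing, so the empty prefix of the remaining chain is covered by
   [sP] instead. *)
- move=> i ile; have := sh i.+1; rewrite /= ltnS => /(_ ile).
  by case: i ile => [_ _|i _] //=.
- split=> //; by rewrite shift1E eqxx eq_sym (negPf (share_neq ef)).
Qed.

(** * Colorings with a single uncolored edge *)

Definition only_uncolored phi e := forall f, phi f = None <-> f = e.

Lemma shift1_only_uncolored phi e f : only_uncolored phi e -> e != f ->
  only_uncolored (shift1 phi e f) f.
Proof.
move=> phie ef g; rewrite shift1E; case: (eqVneq g e) => [->|ge].
  by split=> [/phie fe|E]; move: ef; rewrite ?fe -?E eqxx.
by case: (eqVneq g f) => // gf; split=> [/phie/eqP|/eqP]; rewrite ?(negPf ge) ?(negPf gf).
Qed.

Lemma shift_extends_full phi e psi : only_uncolored phi e ->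
  shift_extends phi e psi -> proper_coloring psi /\ fully_colored psi.
Proof.
move=> phie; case/(shift_extends_ind (I := only_uncolored)) => //.
  by move=> phi' g f ? /share_neq gf *; apply: shift1_only_uncolored.
move=> phi' [f [c [phif phiP _ av ->]]]; split; first exact: color_edge_proper.
by move=> g; rewrite color_edgeE; case: eqVneq => // gf /phif/eqP; rewrite (negPf gf).
Qed.

Lemma recourse_ge m phi psi (g : 'I_m -> edge G) : injective g ->
  (forall i, phi (g i) != None) -> (forall i, psi (g i) != phi (g i)) ->
  m <= recourse phi psi.
Proof.
move=> ginj gphi gpsi; rewrite -[m]card_ord -(card_imset _ ginj).
by apply/subset_leq_card/subsetP => _ /imsetP[i _ ->]; rewrite inE gphi gpsi.
Qed.

Lemma recourse_le phi psi (S : {set edge G}) :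
  (forall f, phi f != None -> f \notin S -> psi f = phi f) ->
  recourse phi psi <= #|S|.
Proof.
move=> phiS; apply/subset_leq_card/subsetP => f; rewrite inE => /andP[pf].
by apply: contraNT => fS; apply/eqP/phiS.
Qed.

(* The colors of [Q] start at the leaves; a shift can never bring one of them
   onto an edge between two low vertices, whatever it does elsewhere. *)
Section Trapped.
Variables (low : pred G) (Q : pred 'I_k).
Hypothesis cover : forall f, exists2 x, x \in val f & low x.

Definition trapped phi :=
  (forall x c, low x -> Q c -> sees phi x c) /\
  (forall f c, (forall x, x \in val f -> low x) -> phi f = Some c -> ~~ Q c).

(** Let [e = zs] and [f = zt]. If a [Q] color moves onto [e], then [s] is not low, since a low [s]
    already has this color on another edge. By [cover], [z] is low, so [t] is not, as [f] carried a
    [Q] color. Hence the only vertex losing the color is not low, and neither is [s] on [e]. *)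
Lemma shift1_trapped phi e f : only_uncolored phi e -> trapped phi ->
  share_one_endpoint e f -> proper_coloring (shift1 phi e f) ->
  trapped (shift1 phi e f).
Proof.
move=> phie [I1 I2] ef /properP sP.
have pe : phi e = None by apply/phie.
have nef := share_neq ef; have nfe : f != e by rewrite eq_sym.
have seen x c : low x -> x \in val e -> x \notin val f -> Q c -> phi f <> Some c.
  move=> lx xe xf Qc fc; have [g xg gc] := I1 x c lx Qc.
  have ge : g != e by apply: contra_eq_neq gc => ->; rewrite pe.
  have gf : g != f by apply: contraNneq xf => <-.
  have /(sP g e x c xg xe) gE : shift1 phi e f g = Some c.
    by rewrite shift1E (negPf ge) (negPf gf).
  by move/eqP: ge; apply; apply: gE; rewrite shift1E eqxx.
have [z [s [t [sz tz st eE fE]]]] := shareP ef.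
have sf : s \notin val f by rewrite fE !inE negb_or sz st.
have se : s \in val e by rewrite eE !inE eqxx orbT.
split=> [x c lx Qc | g c lowg].
- have [g xg gc] := I1 x c lx Qc.
  have ge : g != e by apply: contra_eq_neq gc => ->; rewrite pe.
  have [gf|gf] := eqVneq g f; last first.
    by exists g => //; rewrite shift1E (negPf ge) (negPf gf).
  subst g; have [xe|xe] := boolP (x \in val e).
    by exists e => //; rewrite shift1E eqxx.
  have xt : x = t.
    move: xg xe; rewrite fE eE !inE => /orP[]/eqP-> //; by rewrite eqxx.
  have nlz : ~~ low z.
    apply/negP => lz.
    suff /(I2 f c)/(_ gc) : forall y, y \in val f -> low y by rewrite Qc.
    by move=> y; rewrite fE !inE => /orP[]/eqP-> //; rewrite -xt.
  have ls : low s.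
    have [y] := cover e; rewrite eE !inE => /orP[]/eqP-> //.
    by rewrite (negPf nlz).
  by case: (seen s c).
- rewrite shift1E; case: (eqVneq g e) => [ge|ge]; last by case: ifP => // _; apply: I2.
  move=> fc; apply/negP => Qc; apply: (seen s c) => //.
  by apply: lowg; rewrite ge.
Qed.

(** The last edge has a low endpoint, where every [Q] color is already taken by another edge; so the
    final color is not in [Q] either. *)
Lemma shift_extends_trapped phi e psi : only_uncolored phi e -> trapped phi ->
  shift_extends phi e psi ->
  forall f c, (forall x, x \in val f -> low x) -> psi f = Some c -> ~~ Q c.
Proof.
move=> phie tr; case/(shift_extends_ind
  (I := fun phi e => only_uncolored phi e /\ trapped phi)) => //.
  move=> phi' g f [phig trg] gf *; split.
    exact: shift1_only_uncolored (share_neq gf).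
  exact: shift1_trapped.
move=> phi' [e' [d [[phie' [I1 I2]] phiP pe' av ->]]] f c lowf.
rewrite color_edgeE; case: eqVneq => [fe'|fe']; last exact: I2.
case=> <-; apply/negP => Qd; have [x xe' lx] := cover e'.
have [g xg gd] := I1 x d lx Qd.
apply: (av g) => //; apply: share_edges xe' xg.
by apply: contra_eq_neq gd => <-; rewrite pe'.
Qed.

End Trapped.
End Shifts.

(** * Graphs given by a colored relation *)

(* A graph given with its coloring: [p x y c] says that [xy] is an edge of color
   [c]; the edge from [root p] to [root' p] is added and left uncolored. *)
Record pattern (V : finType) (k : nat) := Pattern {
  pattern_rel :> V -> V -> 'I_k -> bool;
  root : V;
  root' : V;
  pattern_sym : forall x y c, pattern_rel x y c = pattern_rel y x c;
  pattern_irr : forall x c, pattern_rel x x c = false;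
  pattern_fun : forall x y c d, pattern_rel x y c -> pattern_rel x y d -> c = d;
  pattern_inj : forall x y z c, pattern_rel x y c -> pattern_rel x z c -> y = z;
  root_neq : root != root';
  pattern_root_free : forall c, pattern_rel root root' c = false }.

Section PatternGraph.
Variables (V : finType) (k : nat) (p : pattern V k).
Implicit Types (x y z t : V) (c d : 'I_k).

Definition pattern_adj : rel V :=
  fun x y => ([set x; y] == [set root p; root' p]) || [exists c, p x y c].

Lemma pattern_adj_sym : symmetric pattern_adj.
Proof.
move=> x y; rewrite /pattern_adj setUC; congr (_ || _).
by apply: eq_existsb => c; rewrite pattern_sym.
Qed.

Lemma pattern_adj_irrefl : irreflexive pattern_adj.
Proof.
move=> x; rewrite /pattern_adj setUid; apply/norP; split.
  apply/eqP => E; have := cards1 x; rewrite E cards2 (root_neq p); lia.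
by apply/existsP => -[c]; rewrite pattern_irr.
Qed.

Definition pattern_graph : sgraph := SGraph pattern_adj_sym pattern_adj_irrefl.

Definition pattern_coloring : coloring pattern_graph k :=
  [ffun f => [pick c | [exists x, exists y, (val f == [set x; y]) && p x y c]]].

Lemma set2_eq (x y z t : V) : [set x; y] = [set z; t] ->
  (x = z /\ y = t) \/ (x = t /\ y = z).
Proof.
move=> E; have := set21 x y; have := set22 x y; have := set21 z t; have := set22 z t.
rewrite -{1 2}E {3 4}E !inE.
by do 4![case/orP=> /eqP ?]; subst; auto.
Qed.

Lemma pattern_set2 x y z t c : [set x; y] = [set z; t] -> p z t c -> p x y c.
Proof. by case/set2_eq => -[-> ->] //; rewrite pattern_sym. Qed.

Lemma pattern_coloringP f c : pattern_coloring f = Some c <->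
  exists x y, val f = [set x; y] /\ p x y c.
Proof.
rewrite ffunE; split.
  case: pickP => // d /existsP[x /existsP[y /andP[/eqP fE xy]]] [<-].
  by exists x, y.
move=> [x [y [fE xy]]]; case: pickP => [d|none].
  move=> /existsP[z /existsP[t /andP[/eqP fE' zt]]].
  by congr Some; apply: pattern_fun xy; apply: pattern_set2 zt; rewrite -fE.
have /existsP[] := none c.
by exists x; apply/existsP; exists y; rewrite fE eqxx.
Qed.

Lemma pattern_edge x y c : p x y c -> exists2 f : edge pattern_graph,
  val f = [set x; y] & pattern_coloring f = Some c.
Proof.
move=> xy; have fP : [set x; y] \in edge_set pattern_graph.
  rewrite inE; apply/existsP; exists x; apply/existsP; exists y; rewrite eqxx andbT.
  by apply/orP; right; apply/existsP; exists c.
by exists (exist (fun A => is_true (A \in edge_set pattern_graph)) _ fP) => //; apply/pattern_coloringP; exists x, y.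
Qed.

Lemma pattern_at f x c : pattern_coloring f = Some c -> x \in val f ->
  exists2 y, val f = [set x; y] & p x y c.
Proof.
case/pattern_coloringP=> y [z [-> yz]]; rewrite !inE => /orP[]/eqP->; first by exists z.
by exists y; rewrite 1?setUC // pattern_sym.
Qed.

Lemma pattern_sees x y c : p x y c -> sees pattern_coloring x c.
Proof. by case/pattern_edge=> f fE fc; exists f; rewrite // fE set21. Qed.

Lemma pattern_seesP x c : sees pattern_coloring x c -> exists y, p x y c.
Proof. by case=> f xf /pattern_at/(_ xf)[y _ xy]; exists y. Qed.

Lemma pattern_root : exists e : edge pattern_graph, val e = [set root p; root' p].
Proof.
have eP : [set root p; root' p] \in edge_set pattern_graph.
  rewrite inE; apply/existsP; exists (root p); apply/existsP; exists (root' p).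
  by rewrite eqxx andbT; apply/orP; left.
by exists (exist (fun A => is_true (A \in edge_set pattern_graph)) _ eP).
Qed.

Lemma pattern_only_uncolored e : val e = [set root p; root' p] ->
  only_uncolored pattern_coloring e.
Proof.
move=> eE f; split.
  have [x [y [/orP[/eqP xy|/existsP[c xy]] fE]]] := edgeP f.
    by move=> _; apply: val_inj; rewrite eE fE.
  suff -> : pattern_coloring f = Some c by [].
  by apply/pattern_coloringP; exists x, y.
move=> ->; case E: (pattern_coloring e) => [c|] //.
have [x [y [eE' xy]]] := (pattern_coloringP e c).1 E.
by have := pattern_root_free p c; rewrite (@pattern_set2 (root p) (root' p) x y c) // -eE.
Qed.

Lemma pattern_proper : proper_coloring pattern_coloring.
Proof.
apply/properP => e f x c xe xf /pattern_at/(_ xe)[y eE xy] /pattern_at/(_ xf)[z fE xz].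
by apply: val_inj; rewrite eE fE (pattern_inj xy xz).
Qed.

(** By [pattern_inj] and [pattern_fun], the colors at [x] correspond one to one to its neighbors
    along colored edges; the added edge contributes one more at each of its two ends. *)
Lemma pattern_degree x : #|[set y : pattern_graph | @adj pattern_graph x y]| =
  #|[set c | [exists y, p x y c]]| + (x \in [set root p; root' p]).
Proof.
pose N := [set y | [exists c, p x y c]].
pose h c := odflt x [pick y | p x y c].
have hE y c : p x y c -> h c = y.
  rewrite /h => xy; case: pickP => [z xz|/(_ y)]; last by rewrite xy.
  exact: pattern_inj xz xy.
have NE : N = h @: [set c | [exists y, p x y c]].
  apply/setP => y; rewrite inE; apply/existsP/imsetP.
    by move=> [c xy]; exists c; rewrite ?inE ?(hE y) //; apply/existsP; exists y.
  by move=> [c]; rewrite inE => /existsP[z xz] ->; exists c; rewrite (hE z).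
have cN : #|N| = #|[set c | [exists y, p x y c]]|.
  rewrite NE card_in_imset // => c d; rewrite !inE => /existsP[y xy] /existsP[z xz].
  by rewrite (hE y) // (hE z) // => yz; apply: pattern_fun xy _; rewrite yz.
rewrite -cN; have [xuv|xuv] := boolP (x \in [set root p; root' p]); last first.
  rewrite addn0; apply: eq_card => y; rewrite !inE /adj /= /pattern_adj.
  case: eqP => //= E; by case/negP: xuv; rewrite -E set21.
have [w wE] : exists w, [set x; w] = [set root p; root' p].
  by move: xuv; rewrite !inE => /orP[]/eqP->; [exists (root' p)|exists (root p); rewrite setUC].
have wN : w \notin N.
  rewrite inE; apply/existsP => -[c xw].
  by have := pattern_root_free p c; rewrite (pattern_set2 (esym wE) xw).
have -> : [set y : pattern_graph | @adj pattern_graph x y] = w |: N.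
  apply/setP => y; rewrite !inE /adj /= /pattern_adj -wE; congr (_ || _).
  apply/eqP/eqP => [/set2_eq[[_ ->]|[-> ->]]|->] //.
by rewrite cardsU1 wN addnC.
Qed.

End PatternGraph.

(** * The instance on [D + 1] vertices *)

Lemma card_ord_itv k m n : n <= k -> #|[set c : 'I_k | m <= c < n]| = n - m.
Proof.
move=> nk; have ltk (i : 'I_(n - m)) : m + i < k by have := ltn_ord i; lia.
suff -> : [set c : 'I_k | m <= c < n] = [set Ordinal (ltk i) | i : 'I_(n - m)].
  rewrite card_imset ?card_ord // => i j /(congr1 val) /= /addnI; exact: val_inj.
apply/setP => c; rewrite inE; apply/idP/imsetP => [mcn|[i _ ->] /=]; last first.
  by have := ltn_ord i; lia.
have cm : c - m < n - m by lia.
by exists (Ordinal cm) => //; apply: val_inj => /=; lia.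
Qed.

Lemma max_degreeE (G : sgraph) (x : G) D :
  D <= #|[set y : G | adj x y]| ->
  (forall y : G, #|[set z : G | adj y z]| <= D) -> max_degree G = D.
Proof.
move=> Dx Dmax; apply/eqP; rewrite eqn_leq; apply/andP; split.
  exact/bigmax_leqP.
exact: leq_trans Dx (leq_bigmax x).
Qed.

(** Common form of both constructions; [shift_extends] stands for whatever a shift-based algorithm
    may output. *)
Definition hard_instance (D C N K m : nat) : Prop :=
  exists (G : sgraph) (phi : coloring G (D + C)) (e : edge G),
    [/\ #|G| = N, max_degree G = D, proper_coloring phi /\ only_uncolored phi e,
      exists psi : coloring G (D + C),
        [/\ proper_coloring psi, fully_colored psi & recourse phi psi <= K] &
      (exists psi : coloring G (D + C), shift_extends phi e psi) /\
      forall psi : coloring G (D + C), shift_extends phi e psi -> m <= recourse phi psi].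

Section SmallInstance.
Variables (D C : nat).
Hypotheses (D3 : 3 <= D) (CD : C <= D - 3).
Let V : finType := (bool + 'I_(D.-1))%type.

(** Every color occurs at a root: the first [D.-1] at [inl true], the other [C + 1] at [inl false].
    A vertex [inr i] with [D.-1 + i >= D + C] is not joined to [inl false]. *)
Definition small_arc (x y : V) (c : 'I_(D + C)) : bool :=
  if (x, y) is (inl b, inr i) then c == (if b then i : nat else D.-1 + i) :> nat
  else false.

Definition small_rel x y c := small_arc x y c || small_arc y x c.

Lemma small_sym x y c : small_rel x y c = small_rel y x c.
Proof. by rewrite /small_rel orbC. Qed.

Lemma small_irr x c : small_rel x x c = false.
Proof. by case: x. Qed.

Lemma small_fun x y c d : small_rel x y c -> small_rel x y d -> c = d.
Proof.
by case: x y => [b|i] [b'|j]; rewrite /small_rel /= ?orbF // => /eqP cE /eqP dE;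
  apply: val_inj; rewrite /= cE dE.
Qed.

Lemma small_inj x y z c : small_rel x y c -> small_rel x z c -> y = z.
Proof.
case: x y z => [b|i] [b'|j] [b''|l]; rewrite /small_rel /= ?orbF // => /eqP cE /eqP.
  by rewrite cE => E; congr inr; apply: val_inj; move: E {cE} => /=; case: b; lia.
by rewrite cE; have := ltn_ord i; move: cE => _; case: b' b'' => -[] //; lia.
Qed.

Definition small_pattern : pattern V (D + C) :=
  @Pattern V (D + C) small_rel (inl true) (inl false)
    small_sym small_irr small_fun small_inj isT (fun=> erefl).

Lemma small_instance : hard_instance D C D.+1 2 1.
Proof.
pose p := small_pattern.
pose phi := pattern_coloring p.
have [e eE] := pattern_root p.
have phiP : proper_coloring phi := @pattern_proper _ _ p.
have phie : only_uncolored phi e := pattern_only_uncolored eE.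
have pe : phi e = None by apply/phie.
have lt0 : 0 < D.-1 by lia.
have ltc0 : D.-1 < D + C by lia.
have lt1 : 1 < D + C by lia.
(* The chain moves color [D.-1] from the edge between [inl false] and [x0] to the root edge. Color 1
   then fits on the former: [x0] has only 0 and [D.-1], and [inl false] only colors that are at
   least [D.-1 >= 2]. *)
pose x0 : V := inr (Ordinal lt0).
pose c0 := Ordinal ltc0; pose c1 := Ordinal lt1.
have v0 : p (inl false) x0 c0 by apply/orP; left; apply/eqP; rewrite /= addn0.
have [f fE fc] := pattern_edge v0.
have ef : share_one_endpoint e f.
  apply: (@share_edges _ e f (inl false)); rewrite ?eE ?fE ?inE //.
  by apply: contra_eq_neq fc => <-; rewrite pe.
have nfe : f != e by rewrite eq_sym share_neq.
have sP : proper_coloring (shift1 phi e f).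
  apply: (@shift1_proper _ _ phi e f (inl true) c0 phiP ef _ _ fc); rewrite ?eE ?fE ?inE //.
  case/pattern_seesP=> -[b|i]; rewrite /= /small_rel //= orbF => /eqP /= E.
  by have := ltn_ord i; lia.
have av : available (shift1 phi e f) f c1.
  apply: availableP => x g; rewrite fE => xf xg gf; rewrite shift1E (negPf gf).
  case: ifP => _; first by rewrite fc; apply/eqP => -[]; lia.
  apply/eqP => gc; have /pattern_seesP[y] : sees phi x c1 by exists g.
  move: xf; rewrite !inE => /orP[]/eqP->; case: y => [[]|i] //=;
    rewrite /small_rel /= ?orbF // => /eqP /=; lia.
have ext : shift_extends phi e (color_edge (shift1 phi e f) f c1).
  apply: (shift_extends_step phiP pe ef); apply: shift_extends_color => //.
  by rewrite shift1E (negPf nfe) eqxx.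
exists (pattern_graph p), phi, e; split.
- by rewrite card_sum card_bool card_ord; lia.
- apply: (@max_degreeE (pattern_graph p) (inl true)) => [|y].
    rewrite pattern_degree.
    suff -> : [set c | [exists y, small_rel (inl true) y c]] = [set c : 'I_(D + C) | 0 <= c < D.-1].
      have -> : inl true \in [set root p; root' p] by exact: set21.
      by rewrite card_ord_itv; lia.
    apply/setP => c; rewrite !inE /=; apply/existsP/idP.
      by case=> -[b|i]; rewrite /= /small_rel //= orbF => /eqP->.
    by move=> cD; exists (inr (Ordinal cD)); apply/orP; left; apply/eqP.
  case: y => [b|i]; last first.
    apply: (@leq_trans #|[set (inl true); (inl false)]|); last by rewrite cards2; lia.
    apply/subset_leq_card/subsetP => -[[]|j]; rewrite !inE //= => /orP[|/existsP[c]] //.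
    case/eqP/set2_eq => -[] //.
  rewrite pattern_degree.
  have [m [n [nk mn cs]]] : exists m n, [/\ n <= D + C, n - m <= D.-1 &
     forall c : 'I_(D + C), [exists y, small_rel (inl b) y c] -> m <= c < n].
    exists (if b then 0 else D.-1), (if b then D.-1 else D + C).
    split=> [||c /existsP[[b'|i]]]; try by case: b; lia.
      by rewrite /small_rel.
    by rewrite /small_rel /= orbF; have := ltn_ord i; have := ltn_ord c; case: b => ci ii /eqP cE; lia.
  apply: (@leq_trans (D.-1 + 1)); last by lia.
  apply: leq_add; last by case: (_ \in _).
  rewrite (leq_trans _ mn) // -(@card_ord_itv (D + C)) //.
  by apply/subset_leq_card/subsetP => c; rewrite !inE; apply: cs.
- by [].
- have [psiP psif] := shift_extends_full phie ext.
  exists (color_edge (shift1 phi e f) f c1); split=> //.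
  apply: (@leq_trans #|[set e; f]|); last by rewrite cards2; case: (_ != _).
  apply: recourse_le => g _; rewrite !inE => /norP[ge gf].
  by rewrite color_edgeE shift1E (negPf ge) (negPf gf).
- split; first by eexists; exact: ext.
  move=> psi psiE; have [/properP psiP psif] := shift_extends_full phie psiE.
  rewrite lt0n cards_eq0; apply/negP => /eqP S0.
  have same g : g != e -> psi g = phi g.
    move=> ge; apply/eqP; apply: contraT => gn.
    have : g \in (set0 : {set edge (pattern_graph p)}).
      by rewrite -S0 inE gn andbT; apply: contra ge => /eqP/phie->.
    by rewrite inE.
  case ec: (psi e) => [c|]; last by case: (psif e).
  (* With nothing recolored, the color given to [e] still sits on another edge at one of the
     roots. *)
  have [b [y [b2 by_]]] : exists (b : bool) (y : V),
      (inl b : V) \in [set root p; root' p] /\ p (inl b) y c.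
    have [cD|cD] := ltnP c D.-1.
      exists true, (inr (Ordinal cD)); split; first exact: set21.
      by apply/orP; left; apply/eqP.
    have cD' : c - D.-1 < D.-1 by have := ltn_ord c; lia.
    exists false, (inr (Ordinal cD')); split; first exact: set22.
    by apply/orP; left; apply/eqP => /=; lia.
  have [g gE gc] := pattern_edge by_.
  have ge : g != e by apply: contra_eq_neq gc => ->; rewrite pe.
  move/eqP: (ge); apply; apply: (psiP g e (inl b) c) => //.
  + by rewrite gE; exact: set21.
  + by rewrite eE.
  + by rewrite same.
Qed.

End SmallInstance.

(** * Layer sizes and edges between layers *)

Section LayerArithmetic.
Variables (a b : nat).
Hypotheses (b0 : 0 < b) (ba : b <= a).

(* [layer_size k.+2] is the ceiling of [a * layer_size k.+1 / b], the smallest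
   size for which every vertex can have [a] edges up and at most [b] down. *)
Fixpoint layer_size (k : nat) : nat :=
  if k is k'.+1 then
    if k' is 0 then a.+1 else (a * layer_size k' + b.-1) %/ b
  else 1.

Lemma layer_size_SS k :
  layer_size k.+2 = (a * layer_size k.+1 + b.-1) %/ b.
Proof. by []. Qed.

(** Room for the edges of a gap: [a] for each lower vertex, at most [b] for each upper one. *)
Lemma layer_size_flow k : a * layer_size k <= b * layer_size k.+1.
Proof.
case: k => [|k]; first by rewrite /=; nia.
rewrite layer_size_SS mulnC.
have := divn_eq (layer_size k.+1 * a + b.-1) b.
have := ltn_pmod (layer_size k.+1 * a + b.-1) b0.
nia.
Qed.

Lemma layer_size_mono k : layer_size k <= layer_size k.+1.
Proof. have := layer_size_flow k; nia. Qed.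

Lemma layer_size_ge k : a <= layer_size k.+1.
Proof. elim: k => [|k IH] //; exact: leq_trans IH (layer_size_mono _). Qed.

Lemma layer_size_gt0 k : 0 < layer_size k.
Proof. by case: k => // k; apply: leq_trans (layer_size_ge k); lia. Qed.

(* Evenly spread offsets, so that no window of length [s] of the cycle of length
   [s'] contains more than [b] of them when [a * s <= b * s']. *)
Definition offset (s' j : nat) : nat := (j * s') %/ a.

Lemma offset_lt s' j : 0 < s' -> j < a -> offset s' j < s'.
Proof. by move=> s0 ja; rewrite /offset ltn_divLR; nia. Qed.

Lemma offset_mono s' i j : a <= s' -> i < j -> offset s' i < offset s' j.
Proof.
move=> as' ij; rewrite /offset leq_divRL; last by lia.
by have := leq_trunc_div (i * s') a; nia.
Qed.

Lemma offset_inj s' i j : a <= s' -> offset s' i = offset s' j -> i = j.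
Proof.
move=> as' ijE; case: (ltngtP i j) => // /(offset_mono as'); rewrite ijE; lia.
Qed.

(** Each index [j], later the residue of a color modulo [a], acts as a cyclic translation, so edges
    of one color form a matching. *)
Definition up_neighbor (k i j : nat) : nat :=
  (i + offset (layer_size k.+1) j) %% layer_size k.+1.

Lemma up_neighbor_lt k i j : up_neighbor k i j < layer_size k.+1.
Proof. by rewrite ltn_mod layer_size_gt0. Qed.

Lemma up_neighborE k i j : i < layer_size k -> j < a ->
  up_neighbor k i j = if i + offset (layer_size k.+1) j < layer_size k.+1
    then i + offset (layer_size k.+1) j
    else i + offset (layer_size k.+1) j - layer_size k.+1.
Proof.
move=> ik ja; have := offset_lt (layer_size_gt0 k.+1) ja; have := layer_size_mono k.
rewrite /up_neighbor; set o := offset _ _; set s' := layer_size k.+1 => ks os.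
case: ltnP => io; first by rewrite modn_small.
rewrite -[in LHS](subnK io) modnDr modn_small //; lia.
Qed.

Lemma up_neighbor_injl k i i' j : i < layer_size k -> i' < layer_size k -> j < a ->
  up_neighbor k i j = up_neighbor k i' j -> i = i'.
Proof.
move=> ik ik' ja; rewrite !up_neighborE //; have ks := layer_size_mono k.
by case: ltnP => ?; case: ltnP => ?; lia.
Qed.

Lemma up_neighbor_injr k i j j' : i < layer_size k -> j < a -> j' < a ->
  up_neighbor k i j = up_neighbor k i j' -> j = j'.
Proof.
move=> ik ja ja' E; apply: (offset_inj (layer_size_ge k)); move: E.
have := offset_lt (layer_size_gt0 k.+1) ja; have := offset_lt (layer_size_gt0 k.+1) ja'.
move=> oj' oj; rewrite !up_neighborE //; case: ltnP => ?; case: ltnP => ?; lia.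
Qed.

(** Layer 1 has [a.+1] vertices, so the bottom vertex misses exactly index [a]; this is where the
    uncolored edge will end. *)
Lemma up_neighbor0 j : j < a -> up_neighbor 0 0 j = j.
Proof.
move=> ja; rewrite /up_neighbor /= add0n /offset mulnS addnC divnMDl; last by lia.
have -> : j %/ a = 0 by rewrite divn_small.
by rewrite addn0 modn_small; lia.
Qed.

(* Adding [a] to the indices of the edges that do not wrap around the layer puts
   all the indices of the edges down from [y] into one interval of length [b]. *)
Definition down_index (k y j : nat) : nat :=
  if offset (layer_size k.+1) j <= y then j + a else j.

Lemma down_index_bound k y : y < layer_size k.+1 -> exists m, forall i j,
  i < layer_size k -> j < a -> up_neighbor k i j = y ->
  m <= down_index k y j < m + b.
Proof.
move=> yk; pose s := layer_size k; pose s' := layer_size k.+1.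
have flow : a * s <= b * s' := layer_size_flow k.
have mono : s <= s' := layer_size_mono k.
have s'0 : 0 < s' := layer_size_gt0 _.
have a0 : 0 < a by lia.
(* For the unwrapped index [J], the value [J * s' %/ a] lies in the window of [s] values ending at
   [y + s']. Scaled by [a], the window has length [a * s <= b * s'] and so holds at most [b]
   multiples of [s']; the first candidate is [w * a / s'] rounded up. *)
pose w := y + s' - s + 1; exists ((w * a + s'.-1) %/ s') => i j ik ja.
rewrite up_neighborE // /down_index -/s'; set m := _ %/ s'; set o := offset s' j => E.
have os : o < s' := offset_lt s'0 ja.
have [J [JE Jw]] : exists J, J = (if o <= y then j + a else j) /\
    w <= (J * s') %/ a < w + s.
  exists (if o <= y then j + a else j); split=> //.
  have -> : (if o <= y then j + a else j) * s' %/ a = o + (if o <= y then s' else 0).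
    case: ifP => _; last by rewrite addn0.
    by rewrite mulnDl addnC (mulnC a) divnMDl // addnC.
  by move: E; rewrite -/s' -/o /w; case: ifP; case: ifP; lia.
rewrite -JE; move: Jw; rewrite leq_divRL // ltn_divLR //.
have := divn_eq (w * a + s'.-1) s'; have := ltn_pmod (w * a + s'.-1) s'0.
rewrite -/m; nia.
Qed.

Lemma down_index_inj k y j j' : j < a -> j' < a ->
  down_index k y j = down_index k y j' -> j = j'.
Proof. by move=> ja ja'; rewrite /down_index; case: ifP; case: ifP; lia. Qed.

End LayerArithmetic.

(** * The layered instance *)

Section LayeredPattern.
Variables (a b q L k : nat).
Hypotheses (b0 : 0 < b) (ba : b <= a) (q0 : 0 < q) (L1 : 1 < L)
  (kE : k = a + a + q).

Local Notation size_ := (layer_size a b).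
Local Notation T := {i : 'I_L.+1 & 'I_(size_ i)}.
(* The vertices of the layers, their leaves (isolated for the top layer), and
   extra leaves that bring the bottom vertex to degree [a + b + q]. *)
Let V : finType := (T + (T * 'I_q + 'I_b.-1))%type.
Implicit Types (x y z : V) (s t : T) (c d : 'I_k).

Definition lev t : nat := tag t.
Definition idx t : nat := tagged t.

Lemma node_eq s t : lev s = lev t -> idx s = idx t -> s = t.
Proof.
rewrite /lev /idx; case: s t => [i m] [j n] /= /val_inj ij; subst j.
by move=> /val_inj ->.
Qed.

Lemma node_exists i m : i <= L -> m < size_ i -> exists t, lev t = i /\ idx t = m.
Proof.
move=> iL mi; have iL' : i < L.+1 by [].
by exists (existT (fun i : 'I_L.+1 => 'I_(size_ i)) (Ordinal iL') (Ordinal mi)).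
Qed.

Lemma lev_le t : lev t <= L. Proof. exact: (ltn_ord (tag t)). Qed.

Lemma idx_lt t : idx t < size_ (lev t). Proof. exact: (ltn_ord (tagged t)). Qed.

(* The colors below [a] lead up from even layers, the next [a] colors from odd
   layers, and the last [q] colors are for leaves. *)
Definition up_class (i c : nat) : bool := c %/ a == odd i.

Definition arc x y c : bool :=
  match x, y with
  | inl s, inl t =>
      [&& lev t == (lev s).+1, up_class (lev s) c
        & idx t == up_neighbor a b (lev s) (idx s) (c %% a)]
  | inl s, inr (inl (t, l)) => [&& s == t, lev s < L & c == a + a + l :> nat]
  | inl s, inr (inr j) => (lev s == 0) && (c == a + j :> nat)
  | _, _ => false
  end.

Let a0 : 0 < a. Proof. lia. Qed.

Lemma up_classE i (c : nat) : up_class i c = (odd i * a <= c < odd i * a + a).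
Proof.
rewrite /up_class eqn_leq -ltnS ltn_divLR // leq_divRL //; lia.
Qed.

Lemma up_class_eq i (c d : nat) : up_class i c -> up_class i d -> c %% a = d %% a -> c = d.
Proof.
by move=> /eqP ci /eqP di E; rewrite (divn_eq c a) (divn_eq d a) ci di E.
Qed.

Lemma arc_out x y z c : arc x y c -> arc x z c -> y = z.
Proof.
case: x => // s; case: y => [t|[[t l]|j]]; case: z => [t'|[[t' l']|j']] /=.
- case/and3P=> /eqP lt _ /eqP it /and3P[/eqP lt' _ /eqP it']; congr inl.
  by apply: node_eq; rewrite ?lt ?lt' ?it ?it'.
- by rewrite up_classE => /and3P[_ cs _] /and3P[_ _ /eqP cE]; case: odd cs; lia.
- rewrite up_classE => /and3P[_ cs _] /andP[/eqP s0 /eqP cE].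
  by rewrite s0 /= in cs; lia.
- by rewrite up_classE => /and3P[_ _ /eqP cE] /and3P[_ cs _]; case: odd cs; lia.
- case/and3P=> /eqP-> _ /eqP cE /and3P[/eqP-> _ /eqP E].
  by congr (inr (inl (_, _))); apply: ord_inj; lia.
- by case/and3P=> _ _ /eqP cE /andP[_ /eqP]; have := ltn_ord j'; lia.
- rewrite up_classE => /andP[/eqP s0 /eqP cE] /and3P[_ cs _].
  by rewrite s0 /= in cs; lia.
- by case/andP=> _ /eqP cE /and3P[_ _ /eqP]; have := ltn_ord j; lia.
- by case/andP=> _ /eqP cE /andP[_ /eqP E]; congr (inr (inr _)); apply: ord_inj; lia.
Qed.

Lemma arc_in x y z c : arc y x c -> arc z x c -> y = z.
Proof.
case: x y z => [s|[[s l]|j]] [t|//] [t'|//] /=.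
- case/and3P=> /eqP lt ct /eqP it /and3P[/eqP lt' ct' /eqP it']; congr inl.
  have ltt' : lev t = lev t' by lia.
  apply: node_eq => //; apply: (@up_neighbor_injl a b b0 ba (lev t) _ _ (c %% a)).
  + exact: idx_lt.
  + by rewrite ltt'; exact: idx_lt.
  + by rewrite ltn_mod.
  + by rewrite -it {1}ltt' it'.
- by case/and3P=> /eqP-> _ _ /and3P[/eqP->].
- case/andP=> /eqP lt _ /andP[/eqP lt' _]; congr inl; apply: node_eq; rewrite ?lt //.
  by have := idx_lt t; have := idx_lt t'; rewrite lt lt' /=; lia.
Qed.

(** Colors entering a vertex belong to the class of the layer below; those leaving it belong to its
    own class or to leaves. The extra leaves hang on the bottom layer, which no arc enters. *)
Lemma arc_mix x y z c : arc x y c -> ~~ arc z x c.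
Proof.
case: x z => [s|[[s l]|j]] [t|z] //= xy; apply/negP => /and3P[/eqP ls].
rewrite up_classE => ct _; case: y xy => [t'|[[t' l]|j]] /=.
- by rewrite up_classE ls /= => /and3P[_ cs _]; case: odd ct cs => /=; lia.
- by case/and3P=> _ _ /eqP cE; rewrite cE in ct; case: odd ct; lia.
- by rewrite ls.
Qed.

Lemma arc_fun x y c d : arc x y c -> arc x y d -> c = d.
Proof.
case: x y => // s [t|[[t l]|j]] /=.
- case/and3P=> _ cs /eqP ic /and3P[_ ds /eqP id]; apply: val_inj.
  apply: up_class_eq cs ds _; apply: (@up_neighbor_injr a b b0 ba (lev s) (idx s)).
  + exact: idx_lt.
  + by rewrite ltn_mod.
  + by rewrite ltn_mod.
  + by rewrite -ic.
- by case/and3P=> _ _ /eqP cE /and3P[_ _ /eqP dE]; apply: ord_inj; rewrite cE.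
- by case/andP=> _ /eqP cE /andP[_ /eqP dE]; apply: ord_inj; rewrite cE.
Qed.

Lemma arc_asym x y c d : arc x y c -> ~~ arc y x d.
Proof.
case: x y => [s|[[s l]|j]] [t|[[t l']|j']] //= /and3P[/eqP-> _ _].
by apply/negP => /and3P[/eqP]; lia.
Qed.

Definition layered_rel x y c := arc x y c || arc y x c.

Lemma layered_sym x y c : layered_rel x y c = layered_rel y x c.
Proof. by rewrite /layered_rel orbC. Qed.

Lemma layered_irr x c : layered_rel x x c = false.
Proof.
by rewrite /layered_rel orbb; apply/negP => xx; have := arc_asym c xx; rewrite xx.
Qed.

Lemma layered_fun x y c d : layered_rel x y c -> layered_rel x y d -> c = d.
Proof.
case/orP=> xyc /orP[] xyd.
- exact: arc_fun xyc xyd.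
- by rewrite (negPf (arc_asym _ xyc)) in xyd.
- by rewrite (negPf (arc_asym _ xyc)) in xyd.
- exact: arc_fun xyc xyd.
Qed.

Lemma layered_inj x y z c : layered_rel x y c -> layered_rel x z c -> y = z.
Proof.
case/orP=> xy /orP[] xz.
- exact: arc_out xy xz.
- by rewrite (negPf (arc_mix _ xy)) in xz.
- by rewrite (negPf (arc_mix _ xz)) in xy.
- exact: arc_in xy xz.
Qed.

Lemma bottom_size : 0 < size_ (Ordinal (isT : 0 < L.+1)). Proof. by []. Qed.

Definition bottom : T :=
  existT (fun i : 'I_L.+1 => 'I_(size_ i)) (Ordinal (isT : 0 < L.+1)) (Ordinal bottom_size).

Lemma one_lt_layers : 1 < L.+1. Proof. lia. Qed.

Lemma apex_size : a < size_ (Ordinal one_lt_layers). Proof. by []. Qed.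

(** The vertex of layer 1 that the bottom vertex does not reach by a colored edge, hence a vertex
    with no colored edge down. *)
Definition apex : T :=
  existT (fun i : 'I_L.+1 => 'I_(size_ i)) (Ordinal one_lt_layers) (Ordinal apex_size).

Lemma apex_free t c : ~~ arc (inl t) (inl apex) c.
Proof.
apply/negP => /= /and3P[/eqP]; rewrite /lev /idx /= -/(lev t) -/(idx t) => -[lt] ct.
have := idx_lt t; rewrite -lt /= => it.
have -> : idx t = 0 by lia.
have ca : c %% a < a by rewrite ltn_mod.
by rewrite up_neighbor0 // => /eqP; lia.
Qed.

Lemma layered_root c : layered_rel (inl bottom) (inl apex) c = false.
Proof.
rewrite /layered_rel (negPf (apex_free _ _)).
by [].
Qed.

Definition layered_pattern : pattern V k :=
  @Pattern V k layered_rel (inl bottom) (inl apex)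
    layered_sym layered_irr layered_fun layered_inj isT layered_root.

Local Notation p := layered_pattern.
Local Notation G := (pattern_graph p).
Local Notation phi := (pattern_coloring p).

(** * Low vertices and the trapped leaf colors *)

Definition low : pred V := fun x => if x is inl t then lev t < L else false.

Lemma arc_low x y c : arc x y c -> low x.
Proof.
case: x => // s; case: y => [t|[[t l]|j]] /=.
- by case/and3P=> /eqP <- _ _; apply: lev_le.
- by case/and3P.
- by case/andP=> /eqP-> _; lia.
Qed.

Lemma layered_cover (f : edge G) : exists2 x : G, x \in val f & low x.
Proof.
have [x [y [/orP[/eqP xy|/existsP[c /orP[] /arc_low xy]] fE]]] := edgeP f.
- exists (inl bottom); first by rewrite fE xy; exact: set21.
  by rewrite /= /lev /=; lia.
- by exists x => //; rewrite fE set21.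
- by exists y => //; rewrite fE set22.
Qed.

Lemma up_exists s c : lev s < L -> up_class (lev s) c ->
  exists t, lev t = (lev s).+1 /\ arc (inl s) (inl t) c.
Proof.
move=> sL sc.
have [t [lt it]] := node_exists sL (up_neighbor_lt b0 ba (lev s) (idx s) (c %% a)).
by exists t; split=> //=; rewrite lt it sc !eqxx.
Qed.

Lemma leaf_exists s c : lev s < L -> a + a <= c -> exists y, arc (inl s) y c.
Proof.
move=> sL ac; have lq : c - (a + a) < q by have := ltn_ord c; lia.
exists (inr (inl (s, Ordinal lq))); apply/and3P; split=> //.
by apply/eqP => /=; lia.
Qed.

Lemma arc_up s y c : layered_rel (inl s) y c -> up_class (lev s) c ->
  exists t, [/\ y = inl t, lev t = (lev s).+1 & arc (inl s) (inl t) c].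
Proof.
rewrite up_classE => /orP[]; case: y => [t|[[t l]|j]] //=.
- by move=> st _; exists t; split=> //; case/and3P: st => /eqP.
- by case/and3P=> _ _ /eqP cE; case: odd; lia.
- by case/andP=> /eqP-> /eqP cE /=; lia.
- by case/and3P=> /eqP->; rewrite up_classE /= => ct _; case: odd ct; lia.
Qed.

Lemma layered_trapped :
  @trapped G k low (fun c : 'I_k => a + a <= c) phi.
Proof.
split=> [[s|//] c sL ac | f c lowf /pattern_coloringP[x [y [fE xy]]]].
  have [y sy] := leaf_exists sL ac; apply: (@pattern_sees _ _ p _ y).
  by apply/orP; left.
have lx : low x by apply: lowf; rewrite fE set21.
have ly : low y by apply: lowf; rewrite fE set22.
case: x y lx ly xy {fE} => [s|//] [t|//] _ _ /orP[] /and3P[_];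
  by rewrite up_classE -ltnNge; case: odd; lia.
Qed.

Lemma layered_card :
  #|G| = (\sum_(i < L.+1) size_ i) * q.+1 + b.-1.
Proof.
rewrite /= !card_sum card_prod !card_ord card_tagged sumnE big_map big_enum /=.
rewrite (eq_bigr (fun i : 'I_L.+1 => size_ i)) => [|i _]; last by rewrite card_ord.
by rewrite addnA mulnSr [in RHS](addnC (_ * q)).
Qed.

(** * Degrees in the layered graph *)

Definition down_colors t : {set 'I_k} := [set c | [exists s, arc (inl s) (inl t) c]].

(** All these colors lie in one class, so residues modulo [a] separate them, and [down_index_bound]
    puts the corresponding indices into an interval of length [b]. *)
Lemma card_down_colors t : #|down_colors t| <= b.
Proof.
case E: (lev t) => [|i].
  rewrite (_ : down_colors t = set0) ?cards0 //; apply/setP => c; rewrite !inE.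
  by apply/existsP => -[s /= /and3P[/eqP]]; rewrite E.
have ti : idx t < size_ i.+1 by rewrite -E; exact: idx_lt.
have [m mP] := down_index_bound b0 ba ti.
have dP c : c \in down_colors t ->
    up_class i c /\ m <= down_index a b i (idx t) (c %% a) < m + b.
  rewrite inE => /existsP[s /= /and3P[/eqP]]; rewrite E => -[ls] sc /eqP it.
  rewrite -ls in sc it; split=> //; apply: (mP (idx s)) => //; last by rewrite ltn_mod.
  by rewrite ls; exact: idx_lt.
pose h c : 'I_b := insubd (Ordinal b0) (down_index a b i (idx t) (c %% a) - m).
rewrite -(card_in_imset (f := h)) => [|c d /dP[ci cm] /dP[di dm]].
  by apply: leq_trans (max_card _) _; rewrite card_ord.
move/(congr1 val); rewrite !val_insubd !ifT; [move=> E' | lia | lia].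
apply: ord_inj; apply: up_class_eq ci di _.
by apply: (@down_index_inj a b b0 ba i (idx t)); rewrite ?ltn_mod //; lia.
Qed.

Lemma layered_degree (x : G) : #|[set y : G | adj x y]| <= a + b + q.
Proof.
rewrite pattern_degree.
pose leaves := [set c : 'I_k | a + a <= c < k].
have top : #|leaves| = q by rewrite card_ord_itv //; lia.
case: x => [t|z]; last first.
  have -> : (inr z \in [set root p; root' p]) = false by rewrite !inE.
  rewrite addn0; have [m mP] : exists m, forall c, [exists y, p (inr z) y c] -> c = m :> nat.
    case: z => [[t l]|j]; [exists (a + a + l) | exists (a + j)];
      move=> c /existsP[[s|//]] /orP[] //=; by [case/and3P=> _ _ /eqP | case/andP=> _ /eqP].
  apply: (@leq_trans 1); last by lia.
  rewrite -(_ : (m.+1 - m) = 1); last by lia.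
  have [mk|mk] := ltnP m k.
    rewrite -(@card_ord_itv k) //; apply/subset_leq_card/subsetP => c.
    by rewrite !inE => /mP->; lia.
  rewrite (_ : [set _ | _] = set0) ?cards0 //; apply/setP => c; rewrite !inE.
  by apply/negbTE/negP => /mP cm; have := ltn_ord c; lia.
case E: (lev t) => [|i].
  pose first := [set c : 'I_k | 0 <= c < a + b.-1].
  have card_first : #|first| = a + b.-1 by rewrite card_ord_itv; lia.
  apply: (@leq_trans (#|first| + #|leaves| + 1)); last by rewrite card_first top; lia.
  apply: leq_add; last by case: (_ \in _).
  apply: leq_trans (leq_card_setU _ _).1; apply/subset_leq_card/subsetP => c.
  rewrite !inE => /existsP[y /orP[]]; case: y => [s|[[s l]|j]] //=.
  - by rewrite up_classE E /= => /and3P[_ cs _]; lia.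
  - by case/and3P=> _ _ /eqP cE; have := ltn_ord c; lia.
  - by case/andP=> _ /eqP cE; have := ltn_ord j; lia.
  - by rewrite E => /andP[].
pose ups := [set c : 'I_k | odd i.+1 * a <= c < odd i.+1 * a + a].
have card_ups : #|ups| = a by rewrite card_ord_itv; case: odd; lia.
(* The apex has no colored edge down, so the uncolored edge takes one of its [b] places. *)
have down : #|down_colors t| + (inl t \in [set root p; root' p]) <= b.
  have [tr|tr] := boolP (inl t \in _); last by rewrite addn0 card_down_colors.
  have -> : t = apex.
    move: tr; rewrite !inE => /orP[] /eqP[tE] //; by rewrite tE in E.
  rewrite (_ : down_colors _ = set0) ?cards0 //; apply/setP => c; rewrite !inE.
  by apply/existsP => -[s]; rewrite (negPf (apex_free s c)).
apply: (@leq_trans (#|ups :|: leaves :|: down_colors t| + (inl t \in [set root p; root' p]))).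
  rewrite leq_add2r; apply/subset_leq_card/subsetP => c.
  rewrite !inE => /existsP[y /orP[]]; case: y => [s|[[s l]|j]] //=.
  - by rewrite up_classE E => /and3P[_ -> _].
  - by case/and3P=> _ _ /eqP cE; have := ltn_ord c; lia.
  - by rewrite E.
  - by move=> st; apply/orP; right; apply/existsP; exists s.
have U1 := (leq_card_setU (ups :|: leaves) (down_colors t)).1.
have U2 := (leq_card_setU ups leaves).1; rewrite card_ups top in U2.
apply: leq_trans (leq_add (leq_trans U1 (leq_add U2 (leqnn _))) (leqnn _)) _.
by rewrite -addnA; apply: leq_trans (leq_add (leqnn _) down) _; lia.
Qed.

(** The bottom vertex attains the bound: [a] upward edges, [q] leaves, [b.-1] extra leaves and the
    uncolored edge. *)
Lemma layered_max_degree : max_degree G = a + b + q.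
Proof.
apply: (@max_degreeE G (inl bottom)); last exact: layered_degree.
rewrite pattern_degree.
have -> : (inl bottom : V) \in [set root p; root' p] by exact: set21.
pose first := [set c : 'I_k | 0 <= c < a + b.-1].
pose leaves := [set c : 'I_k | a + a <= c < k].
have card_first : #|first| = a + b.-1 by rewrite card_ord_itv; lia.
have card_leaves : #|leaves| = q by rewrite card_ord_itv //; lia.
have disj : first :&: leaves = set0.
  by apply/setP => c; rewrite !inE; apply/negbTE/negP; lia.
apply: (@leq_trans (#|first :|: leaves| + 1)).
  by rewrite cardsU disj cards0 card_first card_leaves; lia.
rewrite leq_add2r; apply/subset_leq_card/subsetP => c.
have bL : lev bottom < L by rewrite /lev /=; lia.
rewrite !inE => /orP[] ck; apply/existsP; last first.
  have [y y_c] := @leaf_exists bottom c bL (proj1 (andP ck)).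
  by exists y; apply/orP; left.
have [ca|ca] := ltnP c a.
  have [t [_ tc]] := @up_exists bottom c bL (ltac:(by rewrite up_classE /=; lia)).
  by exists (inl t); apply/orP; left.
have cb : c - a < b.-1 by lia.
exists (inr (inr (Ordinal cb))); apply/orP; left; apply/andP; split=> //.
by apply/eqP => /=; lia.
Qed.

Lemma up_edge s t c (g : edge G) : val g = [set inl s; inl t] -> phi g = Some c ->
  lev t = (lev s).+1 -> up_class (lev s) c.
Proof.
move=> gE /pattern_coloringP[x [y [gE' xy]]] lt.
have /orP[/and3P[] //|/and3P[/eqP]] : p (inl s) (inl t) c.
  by apply: pattern_set2 xy; rewrite -gE -gE'.
by lia.
Qed.

(** * Flipped edges and the lower bound on the recourse *)

Section Flips.
Variable psi : coloring G k.
Hypotheses (psiP : proper_coloring psi) (psif : fully_colored psi)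
  (psi_low : forall (f : edge G) c,
     (forall x, x \in val f -> low x) -> psi f = Some c -> ~~ (a + a <= c)).

(** Class [i.+1] is the palette that [phi] never uses between layers [i] and [i.+1]. *)
Definition flipped i (g : edge G) : Prop := exists s t c,
  [/\ lev s = i, lev t = i.+1, val g = [set inl s; inl t], psi g = Some c
    & up_class i.+1 c].

Lemma low_edge s t (g : edge G) : lev s < L -> lev t < L ->
  val g = [set inl s; inl t] -> forall x, x \in val g -> low x.
Proof. by move=> sL tL -> x; rewrite !inE => /orP[]/eqP->. Qed.

Lemma up_class_next i c : ~~ (a + a <= c) -> ~~ up_class i c -> up_class i.+1 c.
Proof. by rewrite !up_classE /=; case: odd => /=; lia. Qed.

(* If [psi] puts an up-color of [s] on an edge that had none, then the [a]
   up-edges of [s] cannot all keep up-colors. *)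
Lemma flip_step s (f : edge G) c0 : (lev s).+1 < L -> inl s \in val f ->
  psi f = Some c0 -> up_class (lev s) c0 ->
  (forall c, phi f = Some c -> ~~ up_class (lev s) c) ->
  exists g, flipped (lev s) g.
Proof.
move=> sL sf fc0 sc0 phif.
pose up c := odflt f [pick g : edge G | (inl s \in val g) && (phi g == Some c)].
have upP c : up_class (lev s) c -> inl s \in val (up c) /\ phi (up c) = Some c.
  move=> sc; rewrite /up; case: pickP => [g /andP[-> /eqP] //|none].
  have [t [_ st]] := @up_exists s c (ltnW sL) sc.
  have [g gE gc] : exists2 g : edge G, val g = [set inl s; inl t] & phi g = Some c.
    by apply: pattern_edge; apply/orP; left.
  by have := none g; rewrite gc eqxx gE set21.
pose h c := odflt c (psi (up c)).
have hP c : psi (up c) = Some (h c).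
  by rewrite /h; case E: (psi (up c)) => [d|] //; case: (psif E).
pose S := [set c : 'I_k | up_class (lev s) c].
have [/existsP[c /andP[]]|hS] := boolP [exists c, (c \in S) && (h c \notin S)].
  rewrite !inE => sc hc; have [us uc] := upP c sc.
  have [y gE sy] := pattern_at uc us; have [t [yE lt st]] := arc_up sy sc.
  exists (up c), s, t, (h c); rewrite gE yE; split=> //.
  apply: up_class_next hc; apply: psi_low (hP c).
  by apply: (@low_edge s t); rewrite ?lt ?gE ?yE //; lia.
(* Otherwise [h] maps the up-colors of [s] injectively into themselves, missing [c0], which [psi]
   has on [f] and [f] is none of the edges [up c]. *)
have hSS : h @: S \subset S :\ c0.
  apply/subsetP => _ /imsetP[c cS ->]; rewrite in_setD1; apply/andP; split.
    move: cS; rewrite inE => sc; have [us uc] := upP c sc.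
    apply/eqP => hc0; have uf : up c = f.
      by apply: ((properP psi).1 psiP _ _ (inl s) c0) => //; rewrite hP hc0.
    by have := phif c; rewrite -uf uc sc => /(_ erefl).
  by move: hS; rewrite negb_exists => /forallP/(_ c); rewrite cS negbK.
have hinj : {in S &, injective h}.
  move=> c d; rewrite !inE => sc sd hcd.
  have [us uc] := upP c sc; have [vs vd] := upP d sd.
  have : up c = up d.
    by apply: ((properP psi).1 psiP _ _ (inl s) (h c)) => //; rewrite hP hcd.
  by move=> uE; move: vd; rewrite -uE uc => -[].
have := subset_leq_card hSS; rewrite card_in_imset // (cardsD1 c0 S) inE sc0; lia.
Qed.

(** Flips propagate upward: the wrong class in one gap is the up-class of the upper end [t], so
    [flip_step] applies at [t]. At the start, the uncolored edge is either flipped itself or takes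
    an up-color of the bottom vertex. The bound on [i] keeps both ends low. *)
Lemma flip_exists (e : edge G) i : val e = [set root p; root' p] ->
  i < L.-1 -> exists g, flipped i g.
Proof.
move=> eE; elim: i => [|i IH] iL.
  case ec: (psi e) => [c|]; last by case: (psif ec).
  have ca : ~~ (a + a <= c).
    by apply: psi_low ec; apply: (@low_edge bottom apex e _ _ eE) => //; rewrite /lev /=; lia.
  have [c0|c0] := boolP (up_class 0 c); last first.
    by exists e, bottom, apex, c; split=> //; apply: up_class_next.
  apply: (@flip_step bottom e c) => //.
  - by rewrite eE; exact: set21.
  - by have /(_ e)[_ -> //] := pattern_only_uncolored eE.
have [g [s [t [c [ls lt gE gc tc]]]]] := IH (ltnW iL).
rewrite -lt in tc *; apply: (@flip_step t g c) => //; first by lia.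
  by rewrite gE set22.
move=> d gd; have := @up_edge s t d g gE gd (ltac:(by rewrite lt ls)).
by rewrite lt ls !up_classE /=; case: odd => /=; lia.
Qed.

(** Gaps 1 to [L - 2] each supply a changed edge. Gap 0 is left out because its flipped edge may be
    the uncolored one, which does not count. *)
Lemma flip_recourse (e : edge G) : val e = [set root p; root' p] ->
  L - 2 <= recourse phi psi.
Proof.
move=> eE; have only := pattern_only_uncolored eE.
have /fin_all_exists[g gP] : forall i : 'I_(L - 2), exists g, flipped i.+1 g.
  by move=> i; apply: (flip_exists eE); have := ltn_ord i; lia.
have g_at (i : 'I_(L - 2)) : exists s t c d, [/\ lev s = i.+1, lev t = i.+2,
    val (g i) = [set inl s; inl t], psi (g i) = Some c & phi (g i) = Some d /\ c != d].
  have [s [t [c [ls lt gE gc tc]]]] := gP i.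
  case gd: (phi (g i)) => [d|].
    exists s, t, c, d; split=> //; split=> //.
    have := @up_edge s t d (g i) gE gd (ltac:(by rewrite lt ls)).
    by move=> sd; apply: contraTneq tc => ->; move: sd; rewrite ls !up_classE /=;
       case: odd => /=; lia.
  have ge : g i = e by apply/only.
  have : (inl bottom : G) \in val (g i) by rewrite ge eE; exact: set21.
  rewrite gE !inE => /orP[]/eqP[] E; [move: ls | move: lt]; by rewrite -E.
apply: (recourse_ge (g := g)) => [i j gij|i|i].
- have [s [t [_ [_ [ls lt gE _ _]]]]] := g_at i.
  have [s' [t' [_ [_ [ls' lt' gE' _ _]]]]] := g_at j.
  apply: ord_inj; have : [set (inl s : V); inl t] = [set inl s'; inl t'].
    by rewrite -gE -gE' gij.
  case/set2_eq => -[[sE] [tE]]; move: ls lt; rewrite ?sE ?tE; lia.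
- by have [s [t [c [d [_ _ _ _ [-> _]]]]]] := g_at i.
- have [s [t [c [d [_ _ _ -> [-> cd]]]]]] := g_at i.
  by apply: contra cd => /eqP[->].
Qed.

End Flips.

(** * Extending the coloring with two changes *)

Lemma bottom_unseen c : c = a + a.-1 :> nat -> ~ sees phi (inl bottom : G) c.
Proof.
move=> cE /pattern_seesP[y /orP[]]; case: y => [t|[[t l]|j]] //=.
- by rewrite up_classE => /and3P[_ cs _]; rewrite /lev /= in cs; lia.
- by case/and3P=> _ _ /eqP; lia.
- by move/eqP; have := ltn_ord j; lia.
Qed.

Lemma apex_unseen c : c = 0 :> nat -> ~ sees phi (inl apex : G) c.
Proof.
move=> cE /pattern_seesP[y /orP[]]; case: y => [t|[[t l]|j]] // yc.
- by move: yc; rewrite /= up_classE => /and3P[_ cs _]; rewrite /lev /= in cs; lia.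
- by case/and3P: yc => _ _ /eqP; lia.
- by rewrite (negPf (apex_free t c)) in yc.
Qed.

Lemma leaf_unseen s (l : 'I_q) c : c < a + a ->
  ~ sees phi (inr (inl (s, l)) : G) c.
Proof.
move=> ca /pattern_seesP[y /orP[]]; case: y => [t|[[t l']|j]] //.
by case/and3P=> _ _ /eqP; lia.
Qed.

(* Recolor a leaf edge at each end of the uncolored edge and give their former
   common color to it. *)
Lemma layered_extension (e : edge G) : val e = [set root p; root' p] ->
  exists psi : coloring G k,
    [/\ proper_coloring psi, fully_colored psi & recourse phi psi <= 2].
Proof.
move=> eE; have only := pattern_only_uncolored eE.
have pe : phi e = None by apply/only.
have phiP : proper_coloring phi := @pattern_proper _ _ p.
have [ltbeta ltalpha ltgamma] : [/\ a + a.-1 < k, 0 < k & a + a < k] by split; lia.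
(* [beta] is free at the bottom vertex and [alpha] at the apex; [gamma] is the first leaf color. *)
pose beta : 'I_k := Ordinal ltbeta; pose alpha : 'I_k := Ordinal ltalpha.
pose gamma : 'I_k := Ordinal ltgamma.
have leaf_edge s : lev s < L -> exists2 f : edge G,
    val f = [set inl s; inr (inl (s, Ordinal q0))] & phi f = Some gamma.
  move=> sL; apply: pattern_edge; apply/orP; left; apply/and3P; split=> //.
  by apply/eqP; rewrite /= addn0.
have [fu fuE fuc] : exists2 f : edge G,
    val f = [set inl bottom; inr (inl (bottom, Ordinal q0))] & phi f = Some gamma.
  by apply: leaf_edge; rewrite /lev /=; lia.
have [fv fvE fvc] := leaf_edge apex L1.
pose psi1 := color_edge phi fu beta; pose psi2 := color_edge psi1 fv alpha.
have alpha_beta : alpha <> beta by move/(congr1 val) => /=; clear -a0; lia.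
have alpha_gamma : alpha <> gamma by move/(congr1 val) => /=; clear -a0; lia.
have beta_gamma : beta <> gamma by move/(congr1 val) => /=; clear -a0; lia.
have uv_ : fu != fv.
  apply/eqP => /(congr1 val); rewrite fuE fvE => /set2_eq[[[]]|[]] //.
have ue : fu != e by apply: contra_eq_neq fuc => ->; rewrite pe.
have ve : fv != e by apply: contra_eq_neq fvc => ->; rewrite pe.
have psi1P : proper_coloring psi1.
  apply: color_edge_proper => //; apply: availableP => x f xu xf fn.
  apply/eqP => fb; have : sees phi x beta by exists f.
  move: xu; rewrite fuE !inE => /orP[]/eqP->; first exact: bottom_unseen.
  by apply: leaf_unseen => /=; clear -a0; lia.
have psi2P : proper_coloring psi2.
  apply: color_edge_proper => //; apply: availableP => x f xv xf fn.
  rewrite color_edgeE; case: ifP => _; first by apply/eqP => /Some_inj/esym.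
  apply/eqP => fb; have : sees phi x alpha by exists f.
  move: xv; rewrite fvE !inE => /orP[]/eqP->; first exact: apex_unseen.
  by apply: leaf_unseen => /=; clear -a0; lia.
exists (color_edge psi2 e gamma); split.
- apply: color_edge_proper => //; apply: availableP => x f xe xf fe.
  rewrite !color_edgeE; case: ifP => fv_; first by apply/eqP => /Some_inj.
  case: ifP => fu_; first by apply/eqP => /Some_inj.
  apply/eqP => fc; have phiE := (properP phi).1 phiP.
  move: xe; rewrite eE !inE => /orP[]/eqP xE; rewrite xE in xf.
    by move/eqP: fu_; apply; apply: (phiE f fu (inl bottom) gamma) => //;
       rewrite fuE; exact: set21.
  by move/eqP: fv_; apply; apply: (phiE f fv (inl apex) gamma) => //;
     rewrite fvE; exact: set21.
- move=> f; rewrite !color_edgeE; case: (eqVneq f e) => // fe.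
  by do 2!case: ifP => // _; move/only/eqP; rewrite (negPf fe).
- apply: (@leq_trans #|[set fu; fv]|); last by rewrite cards2; case: (_ != _).
  apply: recourse_le => f pf; rewrite !inE => /norP[fu_ fv_].
  have fe : f != e by apply: contraNneq pf => ->; rewrite pe.
  by rewrite !color_edgeE (negPf fu_) (negPf fv_) (negPf fe).
Qed.

(** * Existence of a useful shiftable chain *)

Lemma node_neq s t : lev s != lev t -> (inl s : V) != inl t.
Proof. by apply: contraNneq => -[->]. Qed.

Lemma up_class_next_off i (c : nat) : up_class i.+1 c -> ~~ up_class i c.
Proof. by rewrite /up_class /= => /eqP->; case: odd. Qed.

(* Alternating two fixed colors, the uncolored edge can be pushed up one layer
   at a time until it reaches the top. *)
Lemma climb m (sg : coloring G k) (g : edge G) s t (alpha beta : 'I_k) :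
  L = lev t + m -> lev t = (lev s).+1 -> val g = [set inl s; inl t] ->
  proper_coloring sg -> only_uncolored sg g ->
  up_class (lev t) beta -> ~ sees sg (inl s : G) beta ->
  up_class (lev s) alpha -> ~ sees sg (inl t : G) alpha ->
  (forall (f : edge G) r, f != g -> inl r \in val f -> lev t <= lev r -> sg f = phi f) ->
  exists psi, shift_extends sg g psi.
Proof.
elim: m sg g s t alpha beta => [|m IH] sg g s t alpha beta Lt lt gE sgP only
  tb sb sa ta same; have sg0 : sg g = None by apply/only.
  (* At the top layer, [beta] would need an edge to a layer that does not exist, so it is free at
     [t] as well. *)
  exists (color_edge sg g beta); apply: shift_extends_color => //.
  apply: availableP => x f xg xf fg; apply/eqP => fb.
  move: xg; rewrite gE !inE => /orP[]/eqP xE; rewrite xE in xf.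
    by apply: sb; exists f.
  rewrite (same f t fg xf (leqnn _)) in fb.
  have [y _ ty] := pattern_at fb xf; have [r [_ lr _]] := arc_up ty tb.
  by have := lev_le r; lia.
have tL : lev t < L by lia.
have [r [lr tr]] := up_exists tL tb.
have [f fE fb] : exists2 f : edge G, val f = [set inl t; inl r] & phi f = Some beta.
  by apply: pattern_edge; apply/orP; left.
have tf : inl t \in val f by rewrite fE set21.
have tg : inl t \in val g by rewrite gE set22.
have sg_ : inl s \in val g by rewrite gE set21.
have sf : inl s \notin val f.
  by rewrite fE !inE; apply/norP; split; apply: node_neq; rewrite ?lr lt; clear; lia.
have rg : inl r \notin val g.
  by rewrite gE !inE; apply/norP; split; apply: node_neq; rewrite lr lt; clear; lia.
have fg : f != g by apply: contraNneq sf => ->.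
have gf : share_one_endpoint g f by apply: share_edges tg tf; rewrite eq_sym.
have fs : sg f = Some beta by rewrite (same f t).
have sgP' : proper_coloring (shift1 sg g f) by apply: (shift1_proper sgP gf sg_ sf fs).
have [psi ext] : exists psi, shift_extends (shift1 sg g f) f psi; last first.
  by exists psi; apply: shift_extends_step ext.
have ab : alpha <> beta.
  by move=> E; move: tb; rewrite lt -E => /up_class_next_off; rewrite sa.
(* The colors swap roles: [t] still misses [alpha], and [r] now misses [beta], which it had only on
   [f]. *)
apply: (IH _ f t r beta alpha) => //.
- by rewrite lr addSn -addnS.
- by apply: shift1_only_uncolored => //; rewrite eq_sym.
- by move: sa; rewrite lr lt !up_classE /= negbK.
- case=> h th; rewrite shift1E; case: ifP => _; first by rewrite fs => -[] /esym.
  by case: ifP => // _ ha; apply: ta; exists h.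
- case=> h rh; rewrite shift1E; case: eqVneq => [hg|_]; first by rewrite -hg rh in rg.
  case: eqVneq => // hf hb; move/eqP: hf; apply.
  apply: ((properP sg).1 sgP h f (inl r) beta) => //.
  by rewrite fE; exact: set22.
- move=> h z hf zh lz; rewrite shift1E (negPf hf).
  case: eqVneq => [hg|hg]; last by apply: (same h z) => //; apply: leq_trans lz; rewrite lr.
  by move: zh; rewrite hg gE !inE => /orP[]/eqP[zE]; move: lz;
    rewrite zE lr ?lt; clear; lia.
Qed.

(** Keeps the lower bound from being vacuous: a shift-based extension does exist. *)
Lemma layered_chain (e : edge G) : val e = [set root p; root' p] ->
  exists psi, shift_extends phi e psi.
Proof.
move=> eE; have [ltbeta ltalpha] : a + a.-1 < k /\ 0 < k by lia.
apply: (@climb L.-1 phi e bottom apex (Ordinal ltalpha) (Ordinal ltbeta)) => //.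
- by rewrite /lev /=; lia.
- exact: pattern_proper.
- exact: pattern_only_uncolored.
- by rewrite up_classE /lev /=; lia.
- exact: bottom_unseen.
- by rewrite up_classE /lev /=; lia.
- exact: apex_unseen.
Qed.

End LayeredPattern.

Lemma layered_instance D C a b q L : 0 < b -> b <= a -> 0 < q -> 1 < L ->
  D = a + b + q -> D + C = a + a + q ->
  hard_instance D C ((\sum_(i < L.+1) layer_size a b i) * q.+1 + b.-1) 2 (L - 2).
Proof.
move=> b0 ba q0 L1 DE kE; pose p := layered_pattern b0 ba q0 L1 kE.
have [e eE] := pattern_root p.
have only := pattern_only_uncolored eE.
exists (pattern_graph p), (pattern_coloring p), e; split.
- exact: layered_card.
- by rewrite layered_max_degree.
- by split; first exact: pattern_proper.
- exact: layered_extension eE.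
- split; first exact: layered_chain eE.
  move=> psi ext; have [psiP psif] := shift_extends_full only ext.
  apply: flip_recourse eE => //.
  exact: (shift_extends_trapped (@layered_cover _ _ _ _ _ b0 ba q0 L1 kE) only
    (layered_trapped b0 ba q0 L1 kE) ext).
Qed.

(** * Estimates of the bounds *)

Section LogBounds.
Local Open Scope ring_scope.
Variable R : realType.

(** From [ln (1 + t) <= t], the denominator is at most [2C/(D-C) <= 3C/D], whence the constant; the
    numerator only grows when [D] is replaced by [D - C]. *)
Lemma log_bound_small_C (D C n : nat) : (3 <= D)%N -> (1 <= C <= D - 3)%N ->
  (3 * C <= D)%N -> (D ^ 2 <= n * C)%N ->
  3^-1 * (D%:R / C%:R * ln (n%:R * C%:R / D%:R ^+ 2)) <= log_bound R D C n.
Proof.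
move=> D3 /andP[C1 CD] CD3 Dn; rewrite /log_bound.
have D0 : 0 < D%:R :> R by rewrite ltr0n; lia.
have C0 : 0 < C%:R :> R by rewrite ltr0n; lia.
have CD' : 3 * C%:R <= D%:R :> R by rewrite -natrM ler_nat.
have Dn' : D%:R ^+ 2 <= n%:R * C%:R :> R by rewrite -natrX -natrM ler_nat.
have x0 : 0 < D%:R - C%:R :> R by lra.
have rhoE : (D%:R + C%:R) / (D%:R - C%:R) = 1 + 2 * C%:R / (D%:R - C%:R) :> R.
  by field; lra.
have t0 : 0 < 2 * C%:R / (D%:R - C%:R) :> R by apply: divr_gt0 => //; lra.
have lnrho : ln ((D%:R + C%:R) / (D%:R - C%:R)) <= 3 * C%:R / D%:R :> R.
  rewrite rhoE; apply: le_trans (le_ln1Dx _) _; first by lra.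
  by rewrite ler_pdivrMr // mulrAC ler_pdivlMr //; nra.
have lnrho0 : 0 < ln ((D%:R + C%:R) / (D%:R - C%:R)) :> R.
  by rewrite rhoE; apply: ln_gt0; lra.
rewrite ler_pdivlMr //.
have y1 : 1 <= n%:R * C%:R / D%:R ^+ 2 :> R by rewrite ler_pdivlMr ?exprn_gt0 // mul1r.
have ly0 : 0 <= ln (n%:R * C%:R / D%:R ^+ 2) :> R by apply: ln_ge0.
have lyle : ln (n%:R * C%:R / D%:R ^+ 2) <= ln (n%:R * C%:R / (D%:R - C%:R) ^+ 2) :> R.
  rewrite ler_ln ?posrE; last 2 first.
  - by lra.
  - by apply: divr_gt0; [nra | apply: exprn_gt0].
  rewrite ler_pM2l; last by nra.
  by rewrite lef_pV2 ?posrE ?exprn_gt0 // ler_pXn2r ?nnegrE //; lra.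
apply: le_trans lyle.
have -> : 3^-1 * (D%:R / C%:R * ln (n%:R * C%:R / D%:R ^+ 2)) *
    ln ((D%:R + C%:R) / (D%:R - C%:R)) =
  ln (n%:R * C%:R / D%:R ^+ 2) *
    (ln ((D%:R + C%:R) / (D%:R - C%:R)) / (3 * C%:R / D%:R)) :> R by field; lra.
rewrite ler_piMr // ler_pdivrMr ?mul1r //; apply: divr_gt0; lra.
Qed.

Lemma half_ln_le (x y : R) : 0 < x -> 0 < y -> x <= y ^+ 2 -> 2^-1 * ln x <= ln y.
Proof.
move=> x0 y0 xy; have : ln x <= ln (y ^+ 2).
  by rewrite ler_ln ?posrE // exprn_gt0.
by rewrite lnXn // mulr2n; lra.
Qed.

(** The denominator is the constant [ln rho] and the numerator is the logarithm of [kappa * n / D],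
    at least half of [ln (n / D)] once [n / D >= kappa ^- 2]. For [eps >= 1] no [C] qualifies. *)
Lemma log_bound_linear_C (eps : R) : 0 < eps -> exists (c : R) (n0 : nat), 0 < c /\
    forall D C n : nat, (3 <= D)%N -> (1 <= C <= D - 3)%N ->
      C%:R = eps * D%:R -> (n0 * D <= n)%N ->
      c * ln (n%:R / D%:R) <= log_bound R D C n.
Proof.
move=> eps0; have [eps1|eps1] := ltP eps 1; last first.
  exists 1, 0%N; split=> // D C n D3 CD CE.
  have : D%:R <= C%:R :> R by rewrite CE; have : 0 <= D%:R :> R by []; nra.
  by rewrite ler_nat; lia.
pose rho := (1 + eps) / (1 - eps); pose kappa := eps / (1 - eps) ^+ 2.
have k0 : 0 < kappa by apply: divr_gt0 => //; apply: exprn_gt0; lra.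
have rho0 : 0 < ln rho by apply: ln_gt0; rewrite /rho ltr_pdivlMr; lra.
exists (2^-1 / ln rho), (Num.Def.truncn (kappa ^- 2)).+1; split.
  by apply: divr_gt0 => //; lra.
move=> D C n D3 CD CE nD; rewrite /log_bound CE.
have D0 : 0 < D%:R :> R by rewrite ltr0n; lia.
have n0 : 0 < n%:R :> R by rewrite ltr0n; lia.
have -> : (D%:R + eps * D%:R) / (D%:R - eps * D%:R) = rho.
  by rewrite /rho; field; rewrite subr_eq0 gt_eqF //=; nra.
have -> : n%:R * (eps * D%:R) / (D%:R - eps * D%:R) ^+ 2 = n%:R / D%:R * kappa.
  by rewrite /kappa; field; rewrite subr_eq0 gt_eqF //=; nra.
rewrite mulrAC ler_pM2r ?invr_gt0 //; apply: half_ln_le.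
- exact: divr_gt0.
- by apply: mulr_gt0 => //; apply: divr_gt0.
have nDk : kappa ^- 2 <= n%:R / D%:R.
  rewrite ler_pdivlMr //; apply: le_trans (_ : (Num.Def.truncn (kappa ^- 2)).+1%:R * D%:R <= _).
    by rewrite ler_pM2r //; apply/ltW/truncnS_gt.
  by rewrite -natrM ler_nat.
have -> : (n%:R / D%:R * kappa) ^+ 2 = n%:R / D%:R * (n%:R / D%:R * kappa ^+ 2) :> R by ring.
rewrite ler_peMr; [by []|exact/ltW/divr_gt0|].
by rewrite -ler_pdivrMr ?exprn_gt0 // div1r.
Qed.

(** As [D - C >= 3], the base of the logarithm is at most [D]; as [D - C <= k] and [n > k ^ 4], its
    argument is at least the square root of [n]. *)
Lemma log_bound_large_C (k : nat) : exists (c : R) (n0 : nat), 0 < c /\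
    forall D C n : nat, (3 <= D)%N -> (1 <= C <= D - 3)%N ->
      (D <= C + k)%N -> (n0 <= n)%N ->
      c * (ln n%:R / ln D%:R) <= log_bound R D C n.
Proof.
exists 2^-1, (k ^ 4).+1; split=> [|D C n D3 /andP[C1 CD] Dk nk]; first by lra.
rewrite /log_bound.
have C0 : 1 <= C%:R :> R by rewrite ler1n.
have n0 : 0 < n%:R :> R by rewrite ltr0n; lia.
have n1 : 1 <= n%:R :> R by rewrite ler1n; lia.
have x3 : 3 <= D%:R - C%:R :> R by rewrite -natrB ?ler_nat; lia.
have xk : D%:R - C%:R <= k%:R :> R by rewrite -natrB ?ler_nat; lia.
have kn : k%:R ^+ 4 <= n%:R :> R by rewrite -natrX ler_nat; lia.
have rhoE : (D%:R + C%:R) / (D%:R - C%:R) = 1 + 2 * C%:R / (D%:R - C%:R) :> R.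
  by field; lra.
have rho1 : 1 < (D%:R + C%:R) / (D%:R - C%:R) :> R.
  by rewrite rhoE ltrDl; apply: divr_gt0; lra.
have rhoD : (D%:R + C%:R) / (D%:R - C%:R) <= D%:R :> R.
  by rewrite ler_pdivrMr; nra.
have lr0 := ln_gt0 rho1.
have lrD : ln ((D%:R + C%:R) / (D%:R - C%:R)) <= ln D%:R :> R.
  by rewrite ler_ln ?posrE; lra.
have ln0 : 0 <= ln n%:R :> R by apply: ln_ge0.
apply: (@le_trans _ _ (2^-1 * ln n%:R / ln ((D%:R + C%:R) / (D%:R - C%:R)))).
  rewrite mulrA; apply: ler_wpM2l; first by lra.
  by rewrite lef_pV2 ?posrE //; lra.
rewrite ler_pM2r ?invr_gt0 //; apply: half_ln_le => //.
  by apply: divr_gt0; [nra | apply: exprn_gt0; lra].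
rewrite expr_div_n ler_pdivlMr; last by apply: exprn_gt0; apply: exprn_gt0; lra.
have x4 : ((D%:R - C%:R) ^+ 2) ^+ 2 <= n%:R :> R.
  by apply: le_trans kn; rewrite -exprM ler_pXn2r ?nnegrE //; lra.
have -> : (n%:R * C%:R) ^+ 2 = n%:R * (n%:R * C%:R ^+ 2) :> R by ring.
rewrite ler_pM2l //; apply: le_trans x4 _.
by rewrite ler_peMr ?(ltW n0) // exprn_ege1.
Qed.

End LogBounds.

(** * Size of the layered graph against the recourse bound *)

Section RecourseBound.
Local Open Scope ring_scope.
Variable R : realType.
Variables (a b : nat).
Hypotheses (b0 : (0 < b)%N) (ba : (b <= a)%N).
Local Notation size_ := (layer_size a b).

Local Notation r := (a%:R / b%:R : R).

Lemma ratio_facts : [/\ 0 < b%:R :> R, 1 <= b%:R :> R, b%:R <= a%:R :> R & 1 <= r].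
Proof.
have b0' : 0 < b%:R :> R by rewrite ltr0n.
by rewrite ler1n ler_nat ler_pdivlMr // mul1r ler_nat.
Qed.

(** For [a = b] the layers stop growing, which makes the depth linear in the number of vertices. *)
Lemma layer_size_const i : a = b -> (size_ i <= a.+1)%N.
Proof.
move=> ab; case: i => [|i] //; elim: i => [|i IH] //.
rewrite layer_size_SS -ltnS ltn_divLR //.
have -> : (a.+2 * b = a * a.+1 + a)%N by rewrite -ab; nia.
by have := leq_mul (leqnn a) IH; lia.
Qed.

(* The slack [b / C] absorbs the rounding in [layer_size]. *)
Lemma layer_size_exp C i : (0 < C)%N -> a = (b + C)%N ->
  (size_ i.+1)%:R + b%:R / C%:R <= 2 * a%:R * r ^+ i :> R.
Proof.
have [bR b1R baR r1] := ratio_facts.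
move=> C0 aE; have CR : 1 <= C%:R :> R by rewrite ler1n.
have aR : a%:R = b%:R + C%:R :> R by rewrite aE natrD.
elim: i => [|i IH].
  rewrite expr0 mulr1 /= -addn1 natrD.
  have : b%:R / C%:R <= b%:R :> R by rewrite ler_pdivrMr; nra.
  by lra.
rewrite layer_size_SS exprSr.
set s := layer_size a b i.+1 in IH *.
have : (((a * s + b.-1) %/ b) * b)%:R <= (a * s + b.-1)%:R :> R.
  by rewrite ler_nat leq_trunc_div.
rewrite natrM natrD natrM; set t := (_ %/ b)%N.
have -> : b.-1%:R = b%:R - 1 :> R by rewrite -subn1 natrB.
move=> tb; have : t%:R <= r * s%:R + 1 :> R.
  by rewrite -(ler_pM2r bR) mulrDl mul1r mulrAC divfK ?gt_eqF //; lra.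
have e : r * (b%:R / C%:R) = b%:R / C%:R + 1 :> R by rewrite aR; field; lra.
have := ler_wpM2l (le_trans ler01 r1) IH; rewrite mulrDr e; lra.
Qed.

(** A geometric sum of ratio [r], where [r - 1 = C / b]. *)
Lemma layer_sum_exp C m : (0 < C)%N -> a = (b + C)%N ->
  C%:R * (\sum_(i < m) (size_ i.+1)%:R) <= 2 * a%:R * b%:R * (r ^+ m - 1) :> R.
Proof.
have [bR b1R baR r1] := ratio_facts.
move=> C0 aE; have CR : 1 <= C%:R :> R by rewrite ler1n.
have aR : a%:R = b%:R + C%:R :> R by rewrite aE natrD.
elim: m => [|m IH]; first by rewrite big_ord0 expr0; lra.
rewrite big_ord_recr /= mulrDr.
have := layer_size_exp m C0 aE.
have : 0 <= b%:R / C%:R :> R by apply: divr_ge0; lra.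
have -> : 2 * a%:R * b%:R * (r ^+ m.+1 - 1) =
    2 * a%:R * b%:R * (r ^+ m - 1) + C%:R * (2 * a%:R * r ^+ m) :> R.
  have br : b%:R * r = b%:R + C%:R :> R by rewrite mulrC divfK ?gt_eqF // aR.
  rewrite exprSr; move: br; set rho := r; set z := rho ^+ m => br.
  have -> : 2 * a%:R * b%:R * (z * rho - 1) = 2 * a%:R * (z * (b%:R * rho) - b%:R) :> R.
    by ring.
  by rewrite br; ring.
by nra.
Qed.

Definition instance_size q L := ((\sum_(i < L.+1) size_ i) * q.+1 + b.-1)%N.

Lemma instance_size_gt q L : (L <= instance_size q L)%N.
Proof.
rewrite /instance_size; apply: leq_trans (leq_addr _ _).
apply: leq_trans (leq_pmulr _ _) => //; apply: leq_trans (leqnSn L) _.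
rewrite -[X in (X <= _)%N]card_ord -sum1_card; apply: leq_sum => i _.
exact: layer_size_gt0.
Qed.

Lemma recourse_bound_C0 D q n L : a = b -> (1 <= q <= 2)%N -> D = (a + b + q)%N ->
  (n < instance_size q L)%N -> recourse_bound R D 0 n <= (3 * L + 4)%:R.
Proof.
move=> ab q12 DE; rewrite /recourse_bound eqxx /instance_size => nL.
rewrite ler_pdivrMr ?ltr0n; last by lia.
rewrite -natrM ler_nat.
have : (\sum_(i < L.+1) size_ i <= 1 + L * a.+1)%N.
  rewrite big_ord_recl /= leq_add2l -[X in (X * _)%N]card_ord -sum_nat_const.
  by apply: leq_sum => i _; exact: (layer_size_const i.+1 ab).
nia.
Qed.

(** The geometric growth gives [n * C / x ^+ 2 <= r ^+ (2 * L + 1)], and [r] is at most the square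
    of the base [(D + C) / x]. *)
Lemma recourse_bound_C_gt0 D C q n L : (0 < C)%N -> a = (b + C)%N -> (1 <= q <= 2)%N ->
  D = (a + b + q)%N -> (0 < n)%N ->
  (n < instance_size q L)%N -> recourse_bound R D C n <= (4 * L + 2)%:R.
Proof.
have [bR b1R baR r1] := ratio_facts.
move=> C0 aE q12 DE n0; rewrite /recourse_bound /instance_size /log_bound.
have -> : (C == 0)%N = false by lia.
rewrite big_ord_recl (eq_bigr (fun i : 'I_L => size_ i.+1)) // => nL.
have CR : 1 <= C%:R :> R by rewrite ler1n.
have nR : 0 < n%:R :> R by rewrite ltr0n.
have aR : a%:R = b%:R + C%:R :> R by rewrite aE natrD.
have DR : D%:R - C%:R = 2 * b%:R + q%:R :> R by rewrite DE aE !natrD; lra.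
have /andP[q1 q2] : (1 <= q%:R :> R) && (q%:R <= 2 :> R) by rewrite ler1n ler_nat.
have qb : q%:R <= 2 * b%:R :> R by lra.
set x := D%:R - C%:R : R.
have x0 : 0 < x by rewrite /x; lra.
have rhoE : (D%:R + C%:R) / x = 1 + 2 * C%:R / x :> R.
  by rewrite /x; field; rewrite -/x; lra.
have rho1 : 1 < (D%:R + C%:R) / x by rewrite rhoE ltrDl; apply: divr_gt0; lra.
(* Since [x = 2b + q <= 4b], [C / b] is at most twice [2C / x], and [1 + 2t <= (1 + t) ^+ 2]. *)
have rrho : r <= ((D%:R + C%:R) / x) ^+ 2.
  have -> : r = 1 + C%:R / b%:R by rewrite aR; field; lra.
  rewrite rhoE.
  have : C%:R / b%:R <= 2 * (2 * C%:R / x) :> R.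
    rewrite ler_pdivrMr // !mulrA mulrAC ler_pdivlMr // /x; nra.
  by have := sqr_ge0 (2 * C%:R / x : R); nra.
rewrite ler_pdivrMr; last exact: ln_gt0.
have sumL := layer_sum_exp L C0 aE.
set P : R := \sum_(i < L) _ in sumL.
have nP : n%:R <= 3 * (1 + P) + b%:R.
  have -> : P = (\sum_(i < L) size_ i.+1)%:R by rewrite natr_sum.
  rewrite -(natrD _ 1) -natrM -natrD ler_nat; apply: leq_trans (ltnW nL) _.
  apply: leq_add (leq_pred _); rewrite [leqRHS]mulnC; apply: leq_mul => //.
  by case/andP: q12.
(* With [z = r ^+ L], the generous exponent absorbs the constants: after [x >= 2b], what remains is
   [(z - 1) * (4z - 2) >= 0]. *)
have y_le : n%:R * C%:R / x ^+ 2 <= (r ^+ (2 * L + 1)).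
  have rm : 1 <= r ^+ L by apply: exprn_ege1.
  rewrite ler_pdivrMr ?exprn_gt0 // exprD mulnC exprM expr1.
  set z := r ^+ L in rm sumL *.
  have zE : z ^+ 2 * r * (4 * b%:R ^+ 2) = 4 * z ^+ 2 * a%:R * b%:R by field; lra.
  apply: (@le_trans _ _ (4 * z ^+ 2 * a%:R * b%:R)); last first.
    rewrite -zE ler_pM2l; first by rewrite /x; nra.
    by apply: mulr_gt0; [apply: exprn_gt0 | ]; lra.
  have nC : n%:R * C%:R <= (3 * (1 + P) + b%:R) * C%:R :> R by rewrite ler_pM2r //; lra.
  have : 3 * C%:R + b%:R * C%:R <= 4 * a%:R * b%:R :> R.
    have : 0 <= C%:R * (b%:R - 1) :> R by apply: mulr_ge0; lra.
    by have := sqr_ge0 (b%:R : R); rewrite aR; lra.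
  have : 0 <= a%:R * b%:R * ((z - 1) * (4 * z - 2)) :> R.
    by apply: mulr_ge0; [nra | apply: mulr_ge0; lra].
  lra.
have y0 : 0 < n%:R * C%:R / x ^+ 2 by apply: divr_gt0; [nra | apply: exprn_gt0].
apply: (@le_trans _ _ (ln (((D%:R + C%:R) / x) ^+ (4 * L + 2)))).
  rewrite ler_ln ?posrE ?exprn_gt0 //; last by lra.
  apply: le_trans y_le _; have -> : (4 * L + 2 = 2 * (2 * L + 1))%N by clear; lia.
  rewrite [leRHS]exprM; apply: lerXn2r rrho; rewrite nnegrE.
    exact: le_trans ler01 r1.
  by apply: exprn_ge0; apply: ltW (lt_trans ltr01 rho1).
by rewrite lnXn ?mulr_natl //; lra.
Qed.

End RecourseBound.

(** * Choosing the instance for given [D], [C] and [n] *)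

Lemma layer_parameters D C : 3 <= D -> C <= D - 3 -> exists a b q,
  [/\ 0 < b, b <= a, 1 <= q <= 2, D = a + b + q & D + C = a + a + q /\ a = b + C].
Proof.
(* [q] gets the parity of [D + C], so that [a] and [b] are the halves of [D + C - q] and
   [D - C - q]. *)
move=> D3 CD; pose q := (~~ odd (D + C)).+1.
have qE : q = if odd (D + C) then 1 else 2 by rewrite /q; case: odd.
have := odd_double_half (D + C - q); have := odd_double_half (D - C - q).
have -> : odd (D - C - q) = false.
  by rewrite !oddB; [rewrite qE oddD; case: odd; case: odd | lia | rewrite qE; case: ifP; lia].
have -> : odd (D + C - q) = false.
  by rewrite oddB; [rewrite qE; case: odd | rewrite qE; case: ifP; lia].
rewrite !add0n -!muln2 => bE aE.
exists (D + C - q)./2, (D - C - q)./2, q.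
have q4 : q = 1 \/ q = 2 /\ ~~ odd (D + C) by rewrite qE; case: odd; [left|right].
by split; try lia; split; lia.
Qed.

Local Open Scope ring_scope.

Theorem mainTheorem4 (R : realType) :
  (exists (K : nat) (c : R), 0 < c /\
    forall D C n : nat, (3 <= D)%N -> (C <= D - 3)%N -> (D < n)%N ->
    exists (G : sgraph) (phi : coloring G (D + C)) (e : edge G),
      [/\ (#|G| <= n)%N,
          max_degree G = D,
          proper_coloring phi /\ (forall f : edge G, phi f = None <-> f = e),
          (exists psi : coloring G (D + C),
             [/\ proper_coloring psi, fully_colored psi & (recourse phi psi <= K)%N]) &
          (exists psi : coloring G (D + C), shift_extends phi e psi) /\
          (forall A : algorithm G (D + C), shift_based A ->
             forall psi : coloring G (D + C), A phi e psi ->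
               c * recourse_bound R D C n <= (recourse phi psi)%:R)])
  /\
  (exists c : R, 0 < c /\
    forall D C n : nat, (3 <= D)%N -> (1 <= C <= D - 3)%N ->
      (3 * C <= D)%N -> (D ^ 2 <= n * C)%N ->
      c * (D%:R / C%:R * ln (n%:R * C%:R / D%:R ^+ 2)) <= log_bound R D C n)
  /\
  (forall eps : R, 0 < eps -> exists (c : R) (n0 : nat), 0 < c /\
    forall D C n : nat, (3 <= D)%N -> (1 <= C <= D - 3)%N ->
      C%:R = eps * D%:R -> (n0 * D <= n)%N ->
      c * ln (n%:R / D%:R) <= log_bound R D C n)
  /\
  (forall k : nat, exists (c : R) (n0 : nat), 0 < c /\
    forall D C n : nat, (3 <= D)%N -> (1 <= C <= D - 3)%N ->
      (D <= C + k)%N -> (n0 <= n)%N ->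
      c * (ln n%:R / ln D%:R) <= log_bound R D C n).
Proof.
split; last split; last split.
(* The constant 20 serves both cases: [4 * 3 + 4 <= 20] for the small instance, and
   [4 * (L + 1) + 4 <= 20 * (L - 2)] for [L >= 3]. *)
- exists 2%N, 20^-1; split=> [|D C n D3 CD Dn]; first by rewrite invr_gt0.
  have [a [b [q [b0 ba q12 DE [kE aE]]]]] := layer_parameters D3 CD.
  have bound L : (n < instance_size a b q L)%N ->
      recourse_bound R D C n <= (4 * L + 4)%:R.
    move=> nL; case: (posnP C) => [C0|C0].
      apply: le_trans (_ : (3 * L + 4)%:R <= _); last by rewrite ler_nat; lia.
      by rewrite C0; apply: (recourse_bound_C0 R b0 ba _ q12 DE nL); lia.
    apply: le_trans (_ : (4 * L + 2)%:R <= _); last by rewrite ler_nat; lia.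
    by apply: (recourse_bound_C_gt0 R b0 ba C0 aE q12 DE _ nL); lia.
  have [m [N [Nn m1 bm [G [phi [e [GN GD [phiP phie] ext [ch low]]]]]]]] :
      exists m N, [/\ (N <= n)%N, (0 < m)%N,
        recourse_bound R D C n <= (20 * m)%:R & hard_instance D C N 2 m].
    have [n3|n3] := ltnP n (instance_size a b q 3).
      exists 1%N, D.+1; split=> //; last exact: small_instance.
      by apply: le_trans (bound _ n3) _; rewrite ler_nat.
    (* Otherwise the largest fitting [L] is taken; that the next size exceeds [n] bounds
       [recourse_bound]. *)
    have ubL L : (instance_size a b q L <= n)%N -> (L <= n)%N.
      exact: leq_trans (instance_size_gt b0 ba q L).
    have exL : exists L, (instance_size a b q L <= n)%N by exists 3%N.
    have [L Ln Lmax] := ex_maxnP exL ubL.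
    have L3 := Lmax _ n3.
    exists (L - 2)%N, (instance_size a b q L); split=> //.
    - by lia.
    - apply: le_trans (bound L.+1 _) _; last by rewrite ler_nat; lia.
      by rewrite ltnNge; apply/negP => /Lmax; rewrite ltnn.
    - by apply: layered_instance => //; lia.
  exists G, phi, e; split=> //; first by rewrite GN.
  split; first exact: ch.
  move=> A shA psi Apsi; apply: le_trans (_ : m%:R <= _).
    by rewrite mulrC ler_pdivrMr // -natrM mulnC.
  rewrite ler_nat; apply: low; exact: (shA phi e psi phiP ((phie e).2 erefl) Apsi).
- exists 3^-1; split; first by rewrite invr_gt0.
  exact: log_bound_small_C.
- exact: log_bound_linear_C.
- exact: log_bound_large_C.
Qed.
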